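(* Let $U\subset\mathbb{C}^n$ be a domain. Then $U$ is pseudoconvex if and only if $U$ is locally pseudoconvex.
   Context: A domain is a connected open set. A function $f\colon U\to\mathbb{R}$ is an exhaustion function for $U$ if $f^{-1}((-\infty,r])$ is compact for every $r\in\mathbb{R}$. An upper-semicontinuous function $f\colon V\to[-\infty,\infty)$ on an open set $V\subset\mathbb{C}$ is subharmonic if for every closed disc $\overline{B(a,r)}\subset V$ ($r>0$) and every continuous $\phi\colon\overline{B(a,r)}\to\mathbb{R}$ that is harmonic on $B(a,r)$ with $\phi\ge f$ on $\partial B(a,r)$, one has $\phi\ge f$ on $B(a,r)$. An upper-semicontinuous $f\colon V\to[-\infty,\infty)$ on an open $V\subset\mathbb{C}^n$ is plurisubharmonic if for every $a\in V$ and $\delta\in\mathbb{C}^n$ with $|\delta|=1$ the function $z\mapsto f(a+\delta z)$ is subharmonic on $\{z\in\mathbb{C}: a+\delta z\in V\}$. A domain $U\subset\mathbb{C}^n$ is pseudoconvex if it admits a continuous plurisubharmonic exhaustion function $U\to\mathbb{R}$. A domain $U\subset\mathbb{C}^n$ is locally pseudoconvex at $a\in\partial U$ if there is an open neighbourhood $V$ of $a$ such that every connected component of $U\cap V$ is pseudoconvex; $U$ is locally pseudoconvex if it is locally pseudoconvex at every $a\in\partial U$. *)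

(* Defs.v *)
From HB Require Import structures.
From mathcomp Require Import all_boot all_order all_algebra.
From mathcomp Require Import all_classical all_reals all_analysis.
From mathcomp Require Import complex.

Set Implicit Arguments.
Unset Strict Implicit.
Unset Printing Implicit Defensive.

Import Order.TTheory GRing.Theory Num.Theory.
Import numFieldNormedType.Exports.

Local Open Scope classical_set_scope.
Local Open Scope ring_scope.
Local Open Scope complex_scope.

(* The library topology on abstract numeric fields, made available on [R[i]]
   itself (the two are convertible). The norm of [z : R[i]] is the modulus as an
   element of [R[i]]; [normc z] is the modulus as an element of [R]. The topology
   of ['rV[R[i]]_n] comes from the sup norm and is the usual one of C^n. *)
HB.instance Definition _ (R : rcfType) := NormedModule.copy R[i] R[i]^o.

Notation normc := ComplexField.Normc.normc.

(* Functions defined on a subset V of C or C^n are represented by total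
   functions; every definition below only depends on the values on V. *)

Section Harmonic.
Variable R : realType.
Implicit Types (D : set R[i]) (phi : R[i] -> R) (z : R[i]).

Definition partial_x phi z : R := derive1 (fun t : R => phi (z + t%:C)) 0.
Definition partial_y phi z : R := derive1 (fun t : R => phi (z + t *i)) 0.

Definition C1_on D phi :=
  forall z, D z ->
    [/\ derivable (fun t : R => phi (z + t%:C)) 0 1,
        derivable (fun t : R => phi (z + t *i)) 0 1,
        {for z, continuous (partial_x phi)} &
        {for z, continuous (partial_y phi)}].

Definition C2_on D phi :=
  [/\ C1_on D phi, C1_on D (partial_x phi) & C1_on D (partial_y phi)].

Definition harmonic_on D phi :=
  C2_on D phi /\
  forall z, D z ->
    partial_x (partial_x phi) z + partial_y (partial_y phi) z = 0.

End Harmonic.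

(* f is upper-semicontinuous on V with values in [-oo, +oo[ *)
Definition usc_on (R : realType) (T : topologicalType) (V : set T)
    (f : T -> \bar R) :=
  forall x, V x ->
    (f x < +oo)%E /\
    forall c : R, (f x < c%:E)%E ->
      \forall y \near within V (nbhs x), (f y < c%:E)%E.

Definition subharmonic_on (R : realType) (V : set R[i]) (f : R[i] -> \bar R) :=
  usc_on V f /\
  forall (a : R[i]) (r : R), 0 < r ->
    [set z : R[i] | normc (z - a) <= r] `<=` V ->
    forall phi : R[i] -> R,
      {within [set z : R[i] | normc (z - a) <= r], continuous phi} ->
      harmonic_on [set z : R[i] | normc (z - a) < r] phi ->
      (forall z : R[i], normc (z - a) = r -> (f z <= (phi z)%:E)%E) ->
      forall z : R[i], normc (z - a) < r -> (f z <= (phi z)%:E)%E.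

Definition euclidean_norm (R : realType) (n : nat) (v : 'rV[R[i]]_n) : R :=
  Num.sqrt (\sum_(k < n) normc (v ord0 k) ^+ 2).

Definition plurisubharmonic_on (R : realType) (n : nat) (V : set 'rV[R[i]]_n)
    (f : 'rV[R[i]]_n -> \bar R) :=
  usc_on V f /\
  forall a d : 'rV[R[i]]_n, V a -> euclidean_norm d = 1 ->
    subharmonic_on [set z | V (a + z *: d)] (fun z => f (a + z *: d)).

Definition exhaustion_on (R : realType) (T : topologicalType) (U : set T)
    (f : T -> R) :=
  forall r : R, compact (U `&` [set x | f x <= r]).

Definition domain (T : topologicalType) (U : set T) := open U /\ connected U.

Definition pseudoconvex (R : realType) (n : nat) (U : set 'rV[R[i]]_n) :=
  domain U /\
  exists f : 'rV[R[i]]_n -> R,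
    [/\ {within U, continuous f},
        plurisubharmonic_on U (EFin \o f) &
        exhaustion_on U f].

Definition boundary (T : topologicalType) (U : set T) :=
  closure U `\` interior U.

Definition locally_pseudoconvex_at (R : realType) (n : nat)
    (U : set 'rV[R[i]]_n) (a : 'rV[R[i]]_n) :=
  exists V : set 'rV[R[i]]_n, open_nbhs a V /\
    forall x, (U `&` V) x -> pseudoconvex (connected_component (U `&` V) x).

Definition locally_pseudoconvex (R : realType) (n : nat)
    (U : set 'rV[R[i]]_n) :=
  forall a, boundary U a -> locally_pseudoconvex_at U a.

(* Main.v *)
(* Plurisubharmonicity is used in viscosity form: a continuous function fails to
   be subharmonic on a line iff it is touched from above at some point of the
   line by [Re (al w + be w^2) - eps |w|^2]. This condition is local, so maxima,
   convex functions and local modifications are immediate. Penalising the distance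
   to a curved disc [a + w d + w^2 e] moves such a contact point onto a complex
   line, which gives the maximum principle on quadratic discs without smoothing.

   If [W] has a plurisubharmonic exhaustion then [1 / dist (., complement of W)]
   is plurisubharmonic: a contact polynomial from above produces a family of
   quadratic discs in [W], with boundaries in a compact set, whose centres tend to
   a boundary point, against the maximum principle for the exhaustion.

   For a locally pseudoconvex [U <> C^n] this makes [1 / dist] plurisubharmonic on
   [U] near its boundary. On [U] cut with a ball, the maximum of [1 / dist], a large
   constant and a convex barrier of the ball is then an exhaustion, so [1 / dist]
   to the complement of the truncated set is plurisubharmonic, and letting the
   ball grow [1 / dist] is plurisubharmonic on all of [U]. Its maximum with the
   norm is the required exhaustion. Conversely, intersect with a ball and take the
   maximum of the given exhaustion with a barrier of the ball. *)
Require Import Defs.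
From mathcomp Require Import all_boot all_order all_algebra.
From mathcomp Require Import all_classical all_reals all_analysis.
From mathcomp Require Import complex ring lra.

Set Implicit Arguments.
Unset Strict Implicit.
Unset Printing Implicit Defensive.

Import Order.TTheory GRing.Theory Num.Theory.
Import numFieldNormedType.Exports.

Local Open Scope classical_set_scope.
Local Open Scope ring_scope.
Local Open Scope complex_scope.

(** * The norm with real values and its topology *)

Section RealNorm.
Variables (R : realType) (V : normedModType R[i]).
Implicit Types (c u v x y : V) (A : set V).

(* The library norm of [V] takes its values in [R[i]]. *)
Definition rnorm v : R := complex.Re `|v|.

Lemma rnormE v : `|v| = (rnorm v)%:C.
Proof. by rewrite /rnorm RRe_real // normr_real. Qed.

Lemma rnorm_ge0 v : 0 <= rnorm v.
Proof. by rewrite -ler0c -rnormE. Qed.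

Lemma rnorm0 : rnorm 0 = 0.
Proof. by rewrite /rnorm normr0. Qed.

Lemma rnorm0_eq0 v : rnorm v = 0 -> v = 0.
Proof. by move=> v0; apply/eqP; rewrite -normr_eq0 rnormE v0. Qed.

Lemma ler_rnormD u v : rnorm (u + v) <= rnorm u + rnorm v.
Proof.
by have := ler_normD u v; rewrite !rnormE lecE => /andP[].
Qed.

Lemma rnormN v : rnorm (- v) = rnorm v.
Proof. by rewrite /rnorm normrN. Qed.

Lemma rnormB u v : rnorm (u - v) = rnorm (v - u).
Proof. by rewrite -rnormN opprB. Qed.

Lemma rnormZ (a : R[i]) v : rnorm (a *: v) = normc a * rnorm v.
Proof. by apply: complexI; rewrite rmorphM -rnormE normrZ rnormE. Qed.

Lemma ler_rnormB_add x y u : rnorm (x - u) <= rnorm (x - y) + rnorm (y - u).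
Proof. by rewrite -(subrKA y) ler_rnormD. Qed.

Lemma ler_dist_rnorm x y : `|rnorm x - rnorm y| <= rnorm (x - y).
Proof.
have h1 := ler_rnormD (x - y) y; have h2 := ler_rnormD (y - x) x.
move: h1 h2; rewrite !subrK (rnormB y) ler_norml => h1 h2; apply/andP; split; lra.
Qed.

Lemma nbhs_rnormP x A :
  nbhs x A <-> exists2 r : R, 0 < r & forall y, rnorm (y - x) < r -> A y.
Proof.
split=> [/nbhs_ballP[e /= e0 eA]|[r r0 rA]].
  have eE : e = (complex.Re e)%:C by rewrite RRe_real // gtr0_real.
  exists (complex.Re e) => [|y]; first by rewrite -ltcR -eE.
  rewrite -ltcR -rnormE -eE => h; apply: eA.
  by rewrite -ball_normE /ball_ /= distrC.
apply/nbhs_ballP; exists r%:C; first by rewrite /= ltcR.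
move=> y; rewrite -ball_normE /ball_ /= => h; apply: rA.
by rewrite -ltcR -rnormE distrC.
Qed.

Lemma near_rnorm x (r : R) : 0 < r -> \forall y \near x, rnorm (y - x) < r.
Proof. by move=> r0; apply/nbhs_rnormP; exists r. Qed.

Lemma continuous_rnormP (f : V -> R) x :
  {for x, continuous f} <->
  forall e : R, 0 < e -> exists2 r : R, 0 < r &
    forall y, rnorm (y - x) < r -> `|f y - f x| < e.
Proof.
split=> [/cvgrPdist_lt cf e e0|cf].
  have /nbhs_rnormP[r r0 rA] := cf _ e0; exists r => // y /rA.
  by rewrite distrC.
apply/cvgrPdist_lt => e e0; have [r r0 rA] := cf _ e0.
by apply/nbhs_rnormP; exists r => // y /rA; rewrite distrC.
Qed.

Lemma rnorm_continuous : continuous rnorm.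
Proof.
move=> x; apply/continuous_rnormP => e e0; exists e => // y.
exact/le_lt_trans/ler_dist_rnorm.
Qed.

Lemma rnormB_continuous c : continuous (fun x => rnorm (x - c)).
Proof.
move=> x; apply: (@continuous_comp _ _ _ (fun y => y - c) rnorm).
  by apply: cvgB; [exact: cvg_id|exact: cvg_cst].
exact: rnorm_continuous.
Qed.

Lemma closed_rnorm_le x (r : R) : closed [set y | rnorm (y - x) <= r].
Proof.
rewrite (_ : mkset _ = (fun y => rnorm (y - x)) @^-1` [set t | t <= r]) //.
apply: preimage_closed; last exact: closed_le.
by move=> y _; exact: rnormB_continuous.
Qed.

Lemma open_rnorm_lt x (r : R) : open [set y | rnorm (y - x) < r].
Proof.
rewrite openE => y /= yr; apply/nbhs_rnormP; exists (r - rnorm (y - x)).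
  by rewrite subr_gt0.
by move=> z zr /=; apply: le_lt_trans (ler_rnormB_add _ y _) _; lra.
Qed.

End RealNorm.

Lemma rnormcE (R : realType) (z : R[i]) : rnorm z = normc z.
Proof. by []. Qed.

(** * Compactness of closed discs and of closed bounded sets in C^n *)

Section Compactness.
Variable R : realType.
Implicit Types z : R[i].

Lemma sqr_normc_ReIm z : normc z ^+ 2 = complex.Re z ^+ 2 + complex.Im z ^+ 2.
Proof. by case: z => a b /=; rewrite sqr_sqrtr // addr_ge0 ?sqr_ge0. Qed.

Lemma ler_Re_normc z : `|complex.Re z| <= normc z.
Proof.
rewrite -(@ler_pXn2r _ 2) ?nnegrE ?rnorm_ge0 //; last exact: (rnorm_ge0 z).
by rewrite sqr_normc_ReIm real_normK ?num_real // lerDl sqr_ge0.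
Qed.

Lemma ler_Im_normc z : `|complex.Im z| <= normc z.
Proof.
rewrite -(@ler_pXn2r _ 2) ?nnegrE ?rnorm_ge0 //; last exact: (rnorm_ge0 z).
by rewrite sqr_normc_ReIm real_normK ?num_real // lerDr sqr_ge0.
Qed.

Lemma normc_real (t : R) : normc t%:C = `|t|.
Proof. by rewrite /= expr0n addr0 sqrtr_sqr. Qed.

Lemma normc_imag (t : R) : normc (t *i) = `|t|.
Proof. by rewrite /= expr0n add0r sqrtr_sqr. Qed.

Lemma complex_split z : z = (complex.Re z)%:C + (complex.Im z) *i.
Proof. by case: z => a b; apply/eqP; rewrite eq_complex /= addr0 add0r !eqxx. Qed.

Lemma normc_le_ReIm z : normc z <= `|complex.Re z| + `|complex.Im z|.
Proof.
rewrite [in normc z](complex_split z) -normc_real -normc_imag.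
exact: (ler_rnormD (complex.Re z)%:C (complex.Im z) *i).
Qed.

(** The disc is a closed subset of the continuous image of a real square, so compactness comes from
    real segments. *)
Lemma compact_closed_disc (z0 : R[i]) (r : R) :
  compact [set z | normc (z - z0) <= r].
Proof.
pose F (p : R * R) : R[i] := z0 + (p.1 +i* p.2).
have cF : continuous F.
  move=> [a b]; apply/cvg_ballP => e e0.
  have eE : e = (complex.Re e)%:C by rewrite RRe_real // gtr0_real.
  have e'0 : 0 < complex.Re e / 2 by rewrite divr_gt0 // -ltcR -eE.
  have h1 : \forall p \near (a, b), `|p.1 - a| < complex.Re e / 2.
    exists (ball a (complex.Re e / 2), setT).
      by split; [exact: nbhsx_ballx|exact: filterT].
    by move=> p [/= + _]; rewrite distrC.
  have h2 : \forall p \near (a, b), `|p.2 - b| < complex.Re e / 2.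
    exists (setT, ball b (complex.Re e / 2)).
      by split; [exact: filterT|exact: nbhsx_ballx].
    by move=> p [_ /=]; rewrite distrC.
  near=> p.
  rewrite -ball_normE /ball_ /= eE rnormE ltcR rnormB rnormcE /F.
  rewrite (_ : _ - _ = (p.1 - a) +i* (p.2 - b)); last first.
    by rewrite opprD addrACA subrr add0r.
  apply: le_lt_trans (normc_le_ReIm _) _ => /=.
  have h3 : `|p.1 - a| < complex.Re e / 2 by near: p.
  have h4 : `|p.2 - b| < complex.Re e / 2 by near: p.
  lra.
have cpt : compact (F @` (`[- r, r]%classic `*` `[- r, r]%classic)).
  apply: continuous_compact; first exact: continuous_subspaceT.
  by apply: compact_setX; exact: segment_compact.
apply: (subclosed_compact _ cpt); first exact: closed_rnorm_le.
move=> z /= zr.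
exists (complex.Re (z - z0), complex.Im (z - z0)).
  by split; rewrite /= in_itv /= -ler_norml;
     [apply: le_trans (ler_Re_normc _) _|apply: le_trans (ler_Im_normc _) _].
by rewrite /F /= -[RHS](subrKC z0); case: (z - z0).
Unshelve. all: by end_near. Qed.

(** The norm is the sup norm, so a bounded set lies in a product of closed discs. *)
Lemma rV_bounded_closed_compact n (A : set 'rV[R[i]]_n) (M : R) :
  (forall v, A v -> rnorm v <= M) -> closed A -> compact A.
Proof.
move=> AM cA.
have cpt : compact [set v : 'rV[R[i]]_n |
    forall i, [set z : R[i] | normc (z - 0) <= M] (v ord0 i)].
  apply: (@rV_compact R[i] n (fun=> [set z | normc (z - 0) <= M])) => _.
  exact: compact_closed_disc.
apply: (subclosed_compact cA cpt) => v /AM vM i /=.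
apply: le_trans vM; rewrite subr0 -rnormcE -lecR -!rnormE.
rewrite [leRHS]/Num.norm /= mx_normE -[leLHS]nngE num_le.
exact: (le_bigmax _ (fun ij => `|v ij.1 ij.2|%:nng) (ord0, i)).
Qed.

End Compactness.

(** * Viscosity plurisubharmonicity: locality, maxima, convex functions *)

Section ViscosityPlurisubharmonic.
Variables (R : realType) (V : normedModType R[i]).
Implicit Types (f g : V -> R) (a d c : V) (z w : R[i]).

(* The viscosity form of plurisubharmonicity: a function that is not
   subharmonic on some complex line is touched from above at some point of that
   line by a harmonic quadratic polynomial minus a multiple of [|w|^2]. *)
Definition psh_at f a := forall d (al be : R[i]) (e rho : R),
  0 < e -> 0 < rho ->
  ~ (forall w, normc w < rho ->
      f (a + w *: d) <= f a + complex.Re (al * w + be * w ^+ 2)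
                            - e * normc w ^+ 2).

Lemma line_near a d (P : set V) : nbhs a P ->
  exists2 rho : R, 0 < rho & forall w, normc w < rho -> P (a + w *: d).
Proof.
move=> /nbhs_rnormP[r r0 rP].
have d1 : 0 < rnorm d + 1 by have := rnorm_ge0 d; lra.
exists (r / (rnorm d + 1)) => [|w wr]; first exact: divr_gt0.
apply: rP; rewrite addrAC subrr add0r rnormZ.
move: wr; rewrite ltr_pdivlMr // => wr.
by apply: le_lt_trans wr; rewrite ler_wpM2l ?(rnorm_ge0 w) // lerDl.
Qed.

(** A polynomial touching [g] from above at [a] also touches the smaller function [f] there. This
    comparison yields both locality and stability under maxima. *)
Lemma psh_at_le f g a : (\forall x \near a, f x <= g x) -> f a = g a ->
  psh_at f a -> psh_at g a.
Proof.
move=> fg fga pf d al be e rho e0 rho0 gw.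
have [r r0 rfg] := line_near d fg.
apply: (pf d al be e (Num.min rho r) e0); first by rewrite lt_min rho0.
move=> w; rewrite lt_min => /andP[w1 w2].
by rewrite fga; apply: le_trans (gw _ w1); exact: rfg.
Qed.

Lemma psh_at_maxl f g a : psh_at f a -> g a <= f a ->
  psh_at (fun x => Num.max (f x) (g x)) a.
Proof.
move=> pf gf; apply: psh_at_le pf; last by rewrite max_l.
by apply: nearW => x; rewrite le_max lexx.
Qed.

Lemma psh_at_maxr f g a : psh_at g a -> f a <= g a ->
  psh_at (fun x => Num.max (f x) (g x)) a.
Proof.
move=> pf gf; apply: psh_at_le pf; last by rewrite max_r.
by apply: nearW => x; rewrite le_max lexx orbT.
Qed.

Lemma psh_at_max f g a : psh_at f a -> psh_at g a ->
  psh_at (fun x => Num.max (f x) (g x)) a.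
Proof.
move=> pf pg; have [h|h] := leP (f a) (g a).
  exact: psh_at_maxr.
by apply: psh_at_maxl; last exact: ltW.
Qed.

(** Summed over w = t, -t, it, -it, the terms Re (al w + be w^2) cancel. A contact polynomial would
    thus bound the four values of [f] by 4 f(a) - 4 e t^2, while midpoint convexity in the
    directions t d and it d bounds them below by 4 f(a). *)
Lemma psh_at_midpoint_convex f a :
  (forall d, exists2 rho : R, 0 < rho & forall w, normc w < rho ->
     f a + f a <= f (a + w *: d) + f (a - w *: d)) ->
  psh_at f a.
Proof.
move=> cf d al be e rho e0 rho0 bad; have [r r0 rf] := cf d.
have m0 : 0 < Num.min rho r by rewrite lt_min rho0.
set t := Num.min rho r / 2.
have t0 : 0 < t by rewrite divr_gt0.
have : t < Num.min rho r by rewrite /t; lra.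
rewrite lt_min => /andP[trho tr].
have nt : normc t%:C = t by rewrite normc_real gtr0_norm.
have nit : normc (t *i) = t by rewrite normc_imag gtr0_norm.
have nN w : normc (- w) = normc w := rnormN w.
have h1 : normc t%:C < rho by rewrite nt.
have h2 : normc (t *i) < rho by rewrite nit.
have h1' : normc (- t%:C) < rho by rewrite nN nt.
have h2' : normc (- t *i) < rho by rewrite nN nit.
have := bad _ h1; have := bad _ h2; have := bad _ h1'; have := bad _ h2'.
rewrite !nN nt nit !scaleNr.
have h3 : normc t%:C < r by rewrite nt.
have h4 : normc (t *i) < r by rewrite nit.
have := rf _ h3; have := rf _ h4.
have : 0 < e * t ^+ 2 by rewrite mulr_gt0 // exprn_gt0.
have : complex.Re (al * t%:C + be * t%:C ^+ 2)
     + complex.Re (al * - t%:C + be * (- t%:C) ^+ 2)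
     + (complex.Re (al * t *i + be * t *i ^+ 2)
     + complex.Re (al * - t *i + be * (- t *i) ^+ 2)) = 0.
  by clear; case: al => a1 a2; case: be => b1 b2; rewrite !expr2 /=; ring.
move: (complex.Re _) (complex.Re _) (complex.Re _) (complex.Re _) (e * _).
move: (f a) (f (a + _)) (f (a - _)) (f (a + _)) (f (a - _)).
clear; move=> ? ? ? ? ? ? ? ? ? ? ? ? ? ? ? ? ? ?; lra.
Qed.

Lemma rnorm_midpoint a c d : rnorm (a - c) + rnorm (a - c) <=
  rnorm (a + d - c) + rnorm (a - d - c).
Proof.
have := ler_rnormD (a + d - c) (a - d - c).
rewrite [a + d - c]addrAC [a - d - c]addrAC addrACA subrr addr0.
rewrite -mulr2n -scaler_nat rnormZ.
have -> : normc (2%:R : R[i]) = 2.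
  by rewrite -(rmorph_nat (real_complex R)) normc_real ger0_norm.
by rewrite mulr_natl mulr2n.
Qed.

Lemma psh_at_rnorm a c : psh_at (fun x => rnorm (x - c)) a.
Proof.
apply: psh_at_midpoint_convex => d; exists 1 => // w _.
exact: rnorm_midpoint.
Qed.

(** The inverse is convex and decreasing and the gap to the sphere is midpoint concave: 1/y + 1/z >=
    4/(y + z) >= 2/x. *)
Lemma psh_at_inv_rnorm a c (r : R) : rnorm (a - c) < r ->
  psh_at (fun x => (r - rnorm (x - c))^-1) a.
Proof.
move=> ar; apply: psh_at_midpoint_convex => d.
have nr : \forall x \near a, rnorm (x - c) < r.
  exact: (open_nbhs_nbhs (conj (open_rnorm_lt c r) ar)).
have [r1 r10 h1] := line_near d nr; exists r1 => // w wr.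
have := rnorm_midpoint a c (w *: d); have := h1 w wr.
have := h1 (- w) (eq_ind_r (fun t => t < r1) wr (rnormN w)); rewrite scaleNr.
move: ar; set s := rnorm _; set s1 := rnorm _; set s2 := rnorm _ => ar h2 h3 h.
have [u0 u1 u2] : [/\ 0 < r - s, 0 < r - s1 & 0 < r - s2] by split; lra.
move: u0 u1 u2 h; set x := r - s; set y := r - s1; set z := r - s2 => u0 u1 u2 h.
have h' : y + z <= x + x by rewrite /x /y /z; lra.
have -> : x^-1 + x^-1 = 2 / x by rewrite mulr_natl mulr2n.
have -> : z^-1 + y^-1 = (y + z) / (y * z) by field; rewrite !gt_eqF.
rewrite ler_pdivrMr // mulrAC ler_pdivlMr ?mulr_gt0 //.
have := sqr_ge0 (y - z); rewrite expr2 => q1.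
have q2 : (y + z) * (y + z) <= (y + z) * (x + x) by rewrite ler_pM2l // addr_gt0.
lra.
Qed.

End ViscosityPlurisubharmonic.

(* Library lemmas with the scalar field fixed to [R[i]]: unification does not
   identify the two convertible topologies on [R[i]] unaided. *)
Section ComplexLimits.
Variables (R : realType) (V : normedModType R[i]).
Context {T : Type} {F : set_system T} {FF : Filter F}.

Lemma cvg_complex_scale (s : T -> R[i]) (f : T -> V) (k : R[i]) (v : V) :
  s x @[x --> F] --> k -> f x @[x --> F] --> v ->
  s x *: f x @[x --> F] --> k *: v.
Proof. exact: (@cvgZ R[i] V T F FF s f k v). Qed.

Lemma cvg_complexZ (s : T -> R[i]) (k : R[i]) (v : V) :
  s x @[x --> F] --> k -> s x *: v @[x --> F] --> k *: v.
Proof. by move=> sk; apply: cvg_complex_scale => //; exact: cvg_cst. Qed.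

Lemma cvg_complexM (s t : T -> R[i]) (k l : R[i]) :
  s x @[x --> F] --> k -> t x @[x --> F] --> l ->
  s x * t x @[x --> F] --> k * l.
Proof. exact: (@cvgM R[i] T F FF s t k l). Qed.

Lemma cvg_complexD (s t : T -> R[i]) (k l : R[i]) :
  s x @[x --> F] --> k -> t x @[x --> F] --> l ->
  s x + t x @[x --> F] --> k + l.
Proof. exact: (@cvgD R[i] R[i] T F FF s t k l). Qed.

Lemma cvg_sqr_normc (s : T -> R[i]) (k : R[i]) :
  s x @[x --> F] --> k -> normc (s x) ^+ 2 @[x --> F] --> normc k ^+ 2.
Proof.
move=> sk; have h : normc (s x) @[x --> F] --> normc k.
  exact: (cvg_comp _ _ sk (@rnorm_continuous R R[i] k)).
by rewrite expr2; apply: cvgM.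
Qed.

End ComplexLimits.

(** * The maximum principle on quadratic discs *)

Section DiscLemma.
Variables (R : realType) (V : normedModType R[i]).
Implicit Types (f g : V -> R) (a d e : V) (z w : R[i]).

Lemma line_continuous a d : continuous (fun z : R[i] => a + z *: d).
Proof.
suff h (z : R[i]) : a + w *: d @[w --> z] --> a + z *: d by [].
have FF : Filter (nbhs z) by exact: nbhs_filter.
apply: cvgD; first exact: cvg_cst.
by apply: cvg_complexZ.
Qed.

(** At [p.2 = 0] this is the quadratic disc itself; the second coordinate displaces it along [e] and
    is the quantity to be penalised. *)
Definition tube a d e (p : R[i] * R[i]) : V :=
  a + p.1 *: d + (p.1 ^+ 2 + p.2) *: e.

Lemma tube_continuous a d e : continuous (tube a d e).
Proof.
move=> p; rewrite /tube.
have c1 : (fun q : R[i] * R[i] => q.1) q @[q --> p] --> p.1 by exact: cvg_fst.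
have c2 : (fun q : R[i] * R[i] => q.2) q @[q --> p] --> p.2 by exact: cvg_snd.
apply: cvgD; first apply: cvgD; first exact: cvg_cst.
  exact: cvg_complexZ c1.
have c3 : (fun q : R[i] * R[i] => q.1 * q.1) q @[q --> p] --> p.1 * p.1.
  by apply: (@cvg_complexM _ _ _ _ _ _ _ _ c1); exact: c1.
exact: cvg_complexZ (cvg_complexD c3 c2).
Qed.

(** Displacing by [- w ^+ 2] cancels the curvature of the disc, so the point moves along a complex
    line, where [psh_at] can be applied. *)
Lemma tube_line a d e (x v w : R[i]) :
  tube a d e (x + w, v - w ^+ 2) =
  tube a d e (x, v) + w *: (d + (x *+ 2) *: e).
Proof.
rewrite /tube /=.
rewrite (_ : (x + w) ^+ 2 + _ = (x ^+ 2 + v) + w * (x *+ 2)); last by ring.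
move: (x ^+ 2 + v) (x *+ 2) => S T; rewrite !scalerDl scalerDr scalerA.
by rewrite (addrA a) (addrACA (a + _)).
Qed.

Lemma sqr_normcD (z w : R[i]) : normc (z + w) ^+ 2 =
  normc z ^+ 2 + complex.Re (z^* * w) *+ 2 + normc w ^+ 2.
Proof.
rewrite !sqr_normc_ReIm; case: z => a b; case: w => c d /=; ring.
Qed.

(** If [f a] exceeded [M], the function f(tube (x, v)) + eps |x|^2 - K |v|^2 would have an interior
    maximum for small v. By [tube_line] this maximum produces a contact polynomial on a complex
    line, which [psh_at] forbids. *)
Lemma psh_disc_max f (Om : set V) a d e (rho M : R) : open Om ->
  (forall x, Om x -> {for x, continuous f}) ->
  (forall x, Om x -> psh_at f x) -> 0 < rho ->
  (forall z, normc z <= rho -> Om (a + z *: d + z ^+ 2 *: e)) ->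
  (forall z, normc z = rho -> f (a + z *: d + z ^+ 2 *: e) <= M) ->
  f a <= M.
Proof.
move=> oOm cf pf rho0 inOm fM; rewrite leNgt; apply/negP => Mfa.
have tube0 z : tube a d e (z, 0) = a + z *: d + z ^+ 2 *: e.
  by rewrite /tube /= addr0.
have tube00 : tube a d e (0, 0) = a.
  by rewrite tube0 expr2 mulr0 !scale0r !addr0.
(* With this choice eps |x|^2 adds at most half of the excess [f a - M]. *)
set eps := (f a - M) / (rho ^+ 2 *+ 2).
have rho2 : 0 < rho ^+ 2 by rewrite exprn_gt0.
have eps0 : 0 < eps by rewrite divr_gt0 ?subr_gt0 // mulrn_wgt0.
have epsE : eps * rho ^+ 2 = (f a - M) / 2.
  by rewrite /eps; field; rewrite gt_eqF.
pose D := [set z : R[i] | normc (z - 0) <= rho].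
have cD : compact D by exact: compact_closed_disc.
have ftc p : Om (tube a d e p) -> {for p, continuous (f \o tube a d e)}.
  move=> h; apply: continuous_comp; first exact: tube_continuous.
  exact: cf.
(* By compactness of [D], one bound on the displacement keeps the whole tube in [Om] and its values
   over the rim too small for a maximum. *)
have [r r0 rP] : exists2 r : R, 0 < r & forall v, normc v < r -> forall x, D x ->
    Om (tube a d e (x, v)) /\
    (normc x < rho \/ f (tube a d e (x, v)) < f a - eps * rho ^+ 2).
  pose P v x := Om (tube a d e (x, v)) /\
    (normc x < rho \/ f (tube a d e (x, v)) < f a - eps * rho ^+ 2).
  have : \forall v \near nbhs (0 : R[i]), D `<=` P v.
    apply: ((compact_near_coveringP D).1 cD) => x; rewrite /D /= subr0 => xD.
    have xOm : Om (tube a d e (x, 0)) by rewrite tube0; exact: inOm.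
    have n1 : \forall p \near (x, 0 : R[i]), Om (tube a d e p).
      exact: (@tube_continuous a d e (x, 0) _ (open_nbhs_nbhs (conj oOm xOm))).
    have n2 : \forall p \near (x, 0 : R[i]),
        normc p.1 < rho \/ f (tube a d e p) < f a - eps * rho ^+ 2.
      have [xlt|] := ltP (normc x) rho.
        exists ([set y | normc (y - 0) < rho], setT) => /=.
          split; last exact: filterT.
          by apply: open_nbhs_nbhs; split; [exact: open_rnorm_lt|rewrite /= subr0].
        by move=> p [/=]; rewrite subr0 => h _; left.
      move=> xge; have xE : normc x = rho by apply/eqP; rewrite eq_le xD.
      have h : (f \o tube a d e) (x, 0) < f a - eps * rho ^+ 2.
        by rewrite /= tube0 epsE; apply: le_lt_trans (fM _ xE) _; lra.
      have nb : nbhs ((f \o tube a d e) (x, 0)) [set s | s < f a - eps * rho ^+ 2].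
        by apply: open_nbhs_nbhs; split; first exact: open_lt.
      have nb' : \forall p \near (x, 0 : R[i]),
          f (tube a d e p) < f a - eps * rho ^+ 2 by exact: ftc xOm _ nb.
      by near=> p; right; near: p; exact: nb'.
    by near=> p => /=; split; [near: p; exact: n1|near: p; exact: n2].
  move=> /nbhs_rnormP[r r0 rP]; exists r => // v vr.
  by apply: rP; rewrite subr0.
pose sg := r / 2; have sg0 : 0 < sg by rewrite divr_gt0.
have sgr : sg < r by rewrite /sg; lra.
pose T := D `*` [set v : R[i] | normc (v - 0) <= sg].
have TOm p : T p -> Om (tube a d e p).
  case: p => x v [/= hx /= hv]; rewrite subr0 in hv.
  by have [] := rP v (le_lt_trans hv sgr) x hx.
have cT : compact T by apply: compact_setX => //; exact: compact_closed_disc.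
have n0 : normc (0 : R[i]) = 0 by exact: (@rnorm0 R R[i]).
have T0 : T (0, 0) by split; rewrite /D /mkset subr0 n0 ltW.
have cn1 : continuous (fun p : R[i] * R[i] => normc p.1 ^+ 2).
  by move=> p; apply: cvg_sqr_normc; exact: cvg_fst.
have cn2 : continuous (fun p : R[i] * R[i] => normc p.2 ^+ 2).
  by move=> p; apply: cvg_sqr_normc; exact: cvg_snd.
pose G K (p : R[i] * R[i]) :=
  f (tube a d e p) + eps * normc p.1 ^+ 2 - K * normc p.2 ^+ 2.
have cG K : {within T, continuous (G K)}.
  apply: continuous_in_subspaceT => p /set_mem/TOm pT.
  apply: cvgB; first apply: cvgD.
  - exact: ftc.
  - by apply: cvgM; [exact: cvg_cst|exact: cn1].
  - by apply: cvgM; [exact: cvg_cst|exact: cn2].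
(* The maximum without penalty comes first: it fixes [K] so large that [G K] is at most [f a - 1]
   where [normc v = sg]. *)
have [p1 _ p1max] := compact_EVT_max (ex_intro _ _ T0) cT (cG 0).
pose K := (G 0 p1 - f a + 1) / sg ^+ 2.
have G00 k : G k (0, 0) = f a.
  by rewrite /G tube00 n0 expr2 !mulr0 addr0 subr0.
have h1 : f a <= G 0 p1 by rewrite -(G00 0); apply: p1max; exact: mem_set.
have sg2 : 0 < sg ^+ 2 by rewrite exprn_gt0.
have K0 : 0 < K by rewrite divr_gt0 //; lra.
have [[x v] /set_mem pT pmax] := compact_EVT_max (ex_intro _ _ T0) cT (cG K).
have h2 : f a <= G K (x, v) by rewrite -(G00 K); apply: pmax; exact: mem_set.
have [/= xD vD] := pT; rewrite subr0 in vD; rewrite /D /= subr0 in xD.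
have vlt : normc v < sg.
  rewrite lt_neqAle vD andbT; apply/eqP => vE.
  have := p1max (x, v) (mem_set pT); move: h2.
  have : K * sg ^+ 2 = G 0 p1 - f a + 1 by rewrite /K divfK // gt_eqF.
  rewrite {2 3}/G /= vE; lra.
have xlt : normc x < rho.
  have [_ []//] := rP v (le_lt_trans vD sgr) x (pT.1).
  move: h2; rewrite /G /= => q1 q2; exfalso.
  have q3 : eps * normc x ^+ 2 <= eps * rho ^+ 2.
    by rewrite ler_pM2l // ler_pXn2r // nnegrE ?(rnorm_ge0 x) // ltW.
  have q4 : 0 <= K * normc v ^+ 2 by rewrite mulr_ge0 ?sqr_ge0 // ltW.
  lra.
(* The first two bounds, with |w| < 1, keep the displaced pair in [T]; the last makes the quartic
   error K |w|^4 at most (eps / 2) |w|^2. *)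
pose t := Num.min (Num.min (rho - normc x) (sg - normc v)) (Num.min 1 (eps / (K *+ 2))).
have t0 : 0 < t.
  by rewrite !lt_min ltr01 !subr_gt0 xlt vlt /= divr_gt0 // mulrn_wgt0.
(* The coefficients come from the cross terms of - eps |x + w|^2 and K |v - w^2|^2. *)
apply: (pf _ (TOm _ pT) (d + (x *+ 2) *: e)
   (- (eps *+ 2)%:C * x^*) (- (K *+ 2)%:C * v^*) (eps / 2) t) => //.
  by rewrite divr_gt0.
move=> w; rewrite !lt_min => /andP[/andP[w1 w2] /andP[w3 w4]].
rewrite -tube_line.
have nw0 : 0 <= normc w := rnorm_ge0 w.
have nw2 : normc w ^+ 2 <= normc w.
  by rewrite expr2 ler_piMl // ltW.
have nww : normc (w ^+ 2) = normc w ^+ 2 by rewrite !expr2 ComplexField.Normc.normcM.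
have nN z : normc (- z) = normc z := rnormN z.
have Tw : T (x + w, v - w ^+ 2).
  split; rewrite /D /mkset subr0.
    by apply: le_trans (ler_rnormD x w) _; rewrite !rnormcE; lra.
  by apply: le_trans (ler_rnormD v (- w ^+ 2)) _; rewrite !rnormcE nN nww; lra.
have := pmax _ (mem_set Tw); rewrite /G /= !sqr_normcD nN nww.
have -> : complex.Re (- (eps *+ 2)%:C * x^* * w + - (K *+ 2)%:C * v^* * w ^+ 2) =
    - (eps * complex.Re (x^* * w)) *+ 2
    + (K * complex.Re (v^* * - w ^+ 2)) *+ 2.
  clear; case: x => x1 x2; case: v => v1 v2; case: w => u1 u2 /=; ring.
have q1 : K * (normc w ^+ 2) ^+ 2 <= eps / 2 * normc w ^+ 2.
  rewrite (expr2 (normc w ^+ 2)) mulrA ler_wpM2r ?sqr_ge0 //.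
  apply: le_trans (_ : K * normc w <= _); first by rewrite ler_pM2l.
  have : normc w * (K *+ 2) < eps by rewrite -ltr_pdivlMr // mulrn_wgt0.
  lra.
move: q1; move: (f _) (f _) (normc _ ^+ 2) (normc _ ^+ 2) (normc _ ^+ 2).
move: (complex.Re _) (complex.Re _) => r1 r2.
move=> f1 f2 m1 m2 m3; lra.
Unshelve. all: by end_near. Qed.

End DiscLemma.

(** * A mean value estimate *)

Section MeanValue.
Variable R : realType.

Lemma is_derive_shift (h : R -> R) (t0 d : R) :
  is_derive (0 : R) (1 : R) (fun t => h (t0 + t)) d -> is_derive t0 (1 : R) h d.
Proof.
move=> [dh hd].
have E : (fun k : R => k^-1 *: (h (k *: (1 : R) + t0) - h t0)) =
    (fun k : R => k^-1 *: (h (t0 + (k *: (1 : R) + 0)) - h (t0 + 0))).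
  by apply/funext => k; rewrite !addr0 (addrC t0).
by split; [rewrite /derivable E|rewrite -hd /derive E].
Qed.

(** This is the mean value theorem for [h] minus its quadratic model; it takes the place of
    integrating a first-order expansion of [dh]. *)
Lemma mean_value_quadratic (h dh : R -> R) (s p q C : R) :
  (forall t, `|t| <= `|s| -> is_derive t (1 : R) h (dh t)) ->
  (forall t, `|t| <= `|s| -> `|dh t - p - q * t| <= C) ->
  `|h s - h 0 - p * s - q * s ^+ 2 / 2| <= C * `|s|.
Proof.
move=> hd bd.
pose k t := h t - p * t - q * t ^+ 2 / 2.
pose dk t := dh t - p - q * t.
have kd t : `|t| <= `|s| -> is_derive t (1 : R) k (dk t).
  move=> /hd ht; rewrite /k; apply: is_derive_eq.
  by rewrite /dk /GRing.scale /= !mulr0; field.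
have kc a b : (forall t, t \in `[a, b] -> `|t| <= `|s|) ->
    {within `[a, b], continuous k}.
  move=> ab; apply: derivable_within_continuous => t /ab/kd [+ _].
  by [].
have -> : h s - h 0 - p * s - q * s ^+ 2 / 2 = k s - k 0.
  by rewrite /k; field.
have [s0|s0] := leP 0 s.
  have I t : t \in `[0, s] -> `|t| <= `|s|.
    by rewrite in_itv /= => /andP[? ?]; rewrite !ger0_norm.
  have [c cI ->] := @MVT_segment _ k dk 0 s s0
    (fun t ti => kd t (I t (subset_itv_oo_cc ti))) (kc _ _ I).
  by rewrite subr0 normrM ler_wpM2r //; apply: bd; exact: I.
have I t : t \in `[s, 0] -> `|t| <= `|s|.
  by rewrite in_itv /= => /andP[st t0]; rewrite (ler0_norm t0) (ltr0_norm s0) lerN2.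
have [c cI E] := @MVT_segment _ k dk s 0 (ltW s0)
  (fun t ti => kd t (I t (subset_itv_oo_cc ti))) (kc _ _ I).
rewrite distrC E sub0r normrM normrN ler_wpM2r //; apply: bd; exact: I.
Qed.

End MeanValue.

(** * Real parts of complex quadratic polynomials *)

Section QuadraticHarmonic.
Variable R : realType.
Implicit Types (A B C z w : R[i]) (phi : R[i] -> R).

(** These are the harmonic comparison functions. The family is closed under both partial
    derivatives, so harmonicity reduces to polynomial identities. *)
Definition quad A B C z : R := complex.Re (A + B * z + C * z ^+ 2).

Lemma cvg_Re {T : Type} {F : set_system T} {FF : Filter F} (s : T -> R[i])
    (k : R[i]) :
  s x @[x --> F] --> k -> complex.Re (s x) @[x --> F] --> complex.Re k.
Proof.
move=> sk; apply: (cvg_comp _ (@complex.Re R) sk).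
apply/continuous_rnormP => e e0; exists e => // y; apply: le_lt_trans.
have -> : complex.Re y - complex.Re k = complex.Re (y - k).
  by clear; case: y k => ? ? [? ?].
exact: ler_Re_normc.
Qed.

Lemma quad_continuous A B C : continuous (quad A B C).
Proof.
suff h (z : R[i]) : quad A B C w @[w --> z] --> quad A B C z by [].
have FF : Filter (nbhs z) by exact: nbhs_filter.
have cz : (fun w : R[i] => w) w @[w --> z] --> z by exact: cvg_id.
have c0 (D : R[i]) : (fun w : R[i] => D) w @[w --> z] --> D.
  exact: cvg_cst.
have c2 : (fun w : R[i] => w * w) w @[w --> z] --> z * z.
  exact: (cvg_complexM cz cz).
have c1 : (fun w : R[i] => B * w) w @[w --> z] --> B * z.
  exact: (cvg_complexM (c0 B) cz).
have c3 : (fun w : R[i] => C * (w * w)) w @[w --> z] --> C * (z * z).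
  exact: (cvg_complexM (c0 C) c2).
have c4 : (fun w : R[i] => A + B * w) w @[w --> z] --> A + B * z.
  exact: (cvg_complexD (c0 A) c1).
exact: (cvg_Re (cvg_complexD c4 c3)).
Qed.

Lemma is_derive_real_quad (p q r : R) :
  is_derive (0 : R) (1 : R) (fun t : R => p + q * t + r * t ^+ 2) q.
Proof.
apply: is_derive_eq; rewrite /GRing.scale /=; ring.
Qed.

Lemma quad_x A B C z :
  is_derive (0 : R) (1 : R) (fun t : R => quad A B C (z + t%:C))
    (quad B (C *+ 2) 0 z).
Proof.
rewrite (_ : (fun t : R => _) = (fun t : R => quad A B C z +
   quad B (C *+ 2) 0 z * t + complex.Re C * t ^+ 2)).
  exact: is_derive_real_quad.
apply/funext => t; rewrite /quad.
case: A => a1 a2; case: B => b1 b2; case: C => c1 c2; case: z => z1 z2 /=; ring.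
Qed.

Lemma quad_y A B C z :
  is_derive (0 : R) (1 : R) (fun t : R => quad A B C (z + t *i))
    (quad ('i%C * B) ('i%C * C *+ 2) 0 z).
Proof.
rewrite (_ : (fun t : R => _) = (fun t : R => quad A B C z +
   quad ('i%C * B) ('i%C * C *+ 2) 0 z * t + complex.Re (- C) * t ^+ 2)).
  exact: is_derive_real_quad.
apply/funext => t; rewrite /quad.
case: A => a1 a2; case: B => b1 b2; case: C => c1 c2; case: z => z1 z2 /=; ring.
Qed.

Lemma partial_x_quad A B C : partial_x (quad A B C) = quad B (C *+ 2) 0.
Proof.
by apply/funext => z; rewrite /partial_x derive1E; have [_ ->] := quad_x A B C z.
Qed.

Lemma partial_y_quad A B C :
  partial_y (quad A B C) = quad ('i%C * B) ('i%C * C *+ 2) 0.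
Proof.
by apply/funext => z; rewrite /partial_y derive1E; have [_ ->] := quad_y A B C z.
Qed.

Lemma C1_on_quad (D : set R[i]) A B C : C1_on D (quad A B C).
Proof.
move=> z _; rewrite partial_x_quad partial_y_quad.
have [? _] := quad_x A B C z; have [? _] := quad_y A B C z.
by split => //; exact: quad_continuous.
Qed.

Lemma harmonic_on_quad (D : set R[i]) A B C : harmonic_on D (quad A B C).
Proof.
split; first by split; rewrite ?partial_x_quad ?partial_y_quad; exact: C1_on_quad.
move=> z _; rewrite !(partial_x_quad, partial_y_quad) /quad.
case: C => c1 c2; case: z => z1 z2 /=; ring.
Qed.

End QuadraticHarmonic.

(** * Second-order expansion of harmonic functions *)

Section Taylor.
Variable R : realType.
Implicit Types (z w : R[i]) (phi : R[i] -> R) (D : set R[i]).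

Lemma C1_on_is_derive_x D phi z (t : R) : C1_on D phi -> D (z + t%:C) ->
  is_derive t (1 : R) (fun u : R => phi (z + u%:C)) (partial_x phi (z + t%:C)).
Proof.
move=> C1 Dz; have [dx _ _ _] := C1 _ Dz; apply: is_derive_shift.
rewrite (_ : (fun u : R => _) = (fun u : R => phi (z + t%:C + u%:C))); last first.
  by apply/funext => u; rewrite rmorphD addrA.
by split => //; rewrite /partial_x derive1E.
Qed.

Lemma C1_on_is_derive_y D phi z (t : R) : C1_on D phi -> D (z + t *i) ->
  is_derive t (1 : R) (fun u : R => phi (z + u *i)) (partial_y phi (z + t *i)).
Proof.
move=> C1 Dz; have [_ dy _ _] := C1 _ Dz; apply: is_derive_shift.
rewrite (_ : (fun u : R => _) = (fun u : R => phi (z + t *i + u *i))); last first.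
  apply/funext => u; rewrite -addrA; congr (phi (_ + _)).
  by apply/eqP; rewrite eq_complex /= addr0 !eqxx.
by split => //; rewrite /partial_y derive1E.
Qed.

(* Only the mixed derivative [partial_x (partial_y phi)] enters: the increment
   is taken first along the real axis and then vertically, so that no symmetry
   of second derivatives is needed. *)
Lemma harmonic_expansion D phi z0 : harmonic_on D phi -> nbhs z0 D ->
  exists al be : R[i], forall e : R, 0 < e -> exists2 rho : R, 0 < rho &
    forall w, normc w < rho ->
      phi (z0 + w) <= phi z0 + complex.Re (al * w + be * w ^+ 2)
                      + e * normc w ^+ 2.
Proof.
move=> [[C1 C1x C1y] lap] nD.
have Dz0 : D z0 := nbhs_singleton nD.
have [_ _ cxx _] := C1x _ Dz0; have [_ _ cyx cyy] := C1y _ Dz0.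
set A := partial_x phi z0; set B := partial_y phi z0.
set a := partial_x (partial_x phi) z0 in cxx *.
set b := partial_x (partial_y phi) z0 in cyx *.
set c := partial_y (partial_y phi) z0 in cyy *.
have ac : c = - a by have := lap _ Dz0; rewrite -/a -/c; lra.
(* For w = s + it these give Re (al w) = A s + B t and, because [c = - a], Re (be w^2) = a s^2 / 2 +
   b s t + c t^2 / 2. *)
exists (A +i* (- B)), ((a / 2) +i* (- (b / 2))) => e e0.
have e2 : 0 < e / 2 by rewrite divr_gt0.
have [r1 r10 h1] := (nbhs_rnormP _ _).1 nD.
have [r2 r20 h2] := (continuous_rnormP _ _).1 cxx _ e2.
have [r3 r30 h3] := (continuous_rnormP _ _).1 cyx _ e2.
have [r4 r40 h4] := (continuous_rnormP _ _).1 cyy _ e2.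
exists (Num.min (Num.min r1 r2) (Num.min r3 r4)).
  by rewrite !lt_min r10 r20 r30 r40.
move=> w; rewrite !lt_min => /andP[/andP[w1 w2] /andP[w3 w4]].
set s := complex.Re w; set t := complex.Im w.
have le_s (u : R) : `|u| <= `|s| -> normc (u%:C) <= normc w.
  by move=> us; rewrite normc_real; apply: le_trans us (ler_Re_normc w).
have le_st (u : R) : `|u| <= `|t| -> normc (s +i* u) <= normc w.
  move=> ut; rewrite -(@ler_pXn2r _ 2) ?nnegrE //; last 2 first.
  - exact: (rnorm_ge0 (s +i* u)).
  - exact: (rnorm_ge0 w).
  rewrite !sqr_normc_ReIm /= lerD2l -(real_normK (num_real u)).
  by rewrite -(real_normK (num_real (complex.Im w))) ler_pXn2r ?nnegrE.
have sh v : z0 + v - z0 = v by rewrite addrAC subrr add0r.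
have inD v (r : R) : normc v <= normc w -> normc w < r -> rnorm (z0 + v - z0) < r.
  by move=> vw wr; rewrite sh; exact: le_lt_trans wr.
have E0 : z0 + 0%:C = z0 by rewrite addr0.
have k1 u : `|u| <= `|s| ->
    `|partial_x phi (z0 + u%:C) - A - a * u| <= e / 2 * `|s|.
  move=> us; have := @mean_value_quadratic R
    (fun u : R => partial_x phi (z0 + u%:C))
    (fun u : R => partial_x (partial_x phi) (z0 + u%:C)) u a 0 (e / 2).
  rewrite mul0r mul0r subr0 E0 => h.
  apply: le_trans (h _ _) _; last by rewrite ler_wpM2l // ltW.
    move=> v vu; apply: C1_on_is_derive_x C1x _.
    by apply: h1; apply: inD w1; apply: le_s; exact: le_trans us.
  move=> v vu; rewrite mul0r subr0; apply: ltW; apply: h2.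
  by apply: inD w2; apply: le_s; exact: le_trans us.
have k2 : `|phi (z0 + s%:C) - phi z0 - A * s - a * s ^+ 2 / 2| <=
    e / 2 * `|s| * `|s|.
  have := @mean_value_quadratic R (fun u : R => phi (z0 + u%:C))
    (fun u : R => partial_x phi (z0 + u%:C)) s A a (e / 2 * `|s|).
  rewrite E0; apply=> // u us; apply: C1_on_is_derive_x C1 _.
  by apply: h1; apply: inD w1; exact: le_s.
have k3 : `|partial_y phi (z0 + s%:C) - B - b * s| <= e / 2 * `|s|.
  have := @mean_value_quadratic R (fun u : R => partial_y phi (z0 + u%:C))
    (fun u : R => partial_x (partial_y phi) (z0 + u%:C)) s b 0 (e / 2).
  rewrite mul0r mul0r subr0 E0; apply=> u us.
    apply: C1_on_is_derive_x C1y _.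
    by apply: h1; apply: inD w1; exact: le_s.
  rewrite mul0r subr0; apply: ltW; apply: h3.
  by apply: inD w3; exact: le_s.
have E1 (u : R) : z0 + s%:C + u *i = z0 + (s +i* u).
  rewrite -addrA; congr (_ + _).
  by apply/eqP; rewrite eq_complex /= addr0 add0r !eqxx.
have E2 : z0 + s%:C + 0 *i = z0 + s%:C.
  by rewrite E1.
have k4 u : `|u| <= `|t| ->
    `|partial_y phi (z0 + s%:C + u *i) - partial_y phi (z0 + s%:C) - c * u| <=
    e / 2 * `|t|.
  move=> ut; have := @mean_value_quadratic R
    (fun u : R => partial_y phi (z0 + s%:C + u *i))
    (fun u : R => partial_y (partial_y phi) (z0 + s%:C + u *i)) u c 0 (e / 2).
  rewrite mul0r mul0r subr0 E2 => h.
  apply: le_trans (h _ _) _; last by rewrite ler_wpM2l // ltW.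
    move=> v vu; apply: C1_on_is_derive_y C1y _; rewrite E1.
    by apply: h1; apply: inD w1; apply: le_st; exact: le_trans ut.
  move=> v vu; rewrite mul0r subr0 E1; apply: ltW; apply: h4.
  by apply: inD w4; apply: le_st; exact: le_trans ut.
(* The vertical step starts at [z0 + s%:C], where by [k3] the slope is [B + b * s] up to
   [e / 2 * |s|]; [k4] controls its change along the step. *)
have k5 : `|phi (z0 + s%:C + t *i) - phi (z0 + s%:C) - (B + b * s) * t
    - c * t ^+ 2 / 2| <= e / 2 * (`|s| + `|t|) * `|t|.
  have := @mean_value_quadratic R (fun u : R => phi (z0 + s%:C + u *i))
    (fun u : R => partial_y phi (z0 + s%:C + u *i)) t (B + b * s) c
    (e / 2 * (`|s| + `|t|)).
  rewrite E2; apply=> u ut.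
    apply: C1_on_is_derive_y C1 _; rewrite E1.
    by apply: h1; apply: inD w1; exact: le_st.
  have := k4 _ ut; have := k3; rewrite !ler_norml.
  set X := partial_y _ _; set Y := partial_y _ _ => /andP[p1 p2] /andP[p3 p4].
  apply/andP; split; lra.
rewrite E1 (_ : s +i* t = w) in k5; last by rewrite /s /t; case: (w).
have -> : complex.Re ((A +i* (- B)) * w + ((a / 2) +i* (- (b / 2))) * w ^+ 2) =
    A * s + B * t + a * s ^+ 2 / 2 + b * s * t + c * t ^+ 2 / 2.
  by rewrite ac /s /t; case: (w) => w1' w2' /=; field.
rewrite sqr_normc_ReIm -/s -/t.
move: k2 k5; rewrite !ler_norml => /andP[_ p1] /andP[_ p2].
(* The errors of [k2] and [k5] add up to e/2 times s^2 + |s||t| + t^2, and that sum is at most 3/2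
   |w|^2. *)
have p3 : `|s| * `|t| <= (s ^+ 2 + t ^+ 2) / 2.
  have := sqr_ge0 (`|s| - `|t|).
  by rewrite sqrrB !real_normK ?num_real //; lra.
have p4 : `|s| * `|s| = s ^+ 2 by rewrite -expr2 real_normK ?num_real.
have p5 : `|t| * `|t| = t ^+ 2 by rewrite -expr2 real_normK ?num_real.
have p6 : e / 2 * (`|s| * `|s| + `|s| * `|t| + `|t| * `|t|) <=
    e * (s ^+ 2 + t ^+ 2).
  rewrite p4 p5 -mulrA ler_pM2l //.
  have := sqr_ge0 s; have := sqr_ge0 t; lra.
lra.
Qed.

End Taylor.

(** * Equivalence of the classical and the viscosity definitions *)

Section Equivalence.
Variables (R : realType) (n : nat).
Notation E := 'rV[R[i]]_n.
Implicit Types (f : E -> R) (a d : E) (Om : set E) (z w : R[i]).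

Lemma euclidean_norm_real_scale (s : R) d : 0 <= s ->
  euclidean_norm (s%:C *: d) = s * euclidean_norm d.
Proof.
move=> s0; rewrite /euclidean_norm.
rewrite (eq_bigr (fun k => s ^+ 2 * normc (d ord0 k) ^+ 2)); last first.
  move=> k _; rewrite mxE -exprMn; congr (_ ^+ 2).
  by rewrite ComplexField.Normc.normcM normc_real ger0_norm.
by rewrite -mulr_sumr sqrtrM ?sqr_ge0 // sqrtr_sqr ger0_norm.
Qed.

Lemma euclidean_norm_gt0 d : d != 0 -> 0 < euclidean_norm d.
Proof.
move=> d0; have [k dk] : exists k, d ord0 k != 0.
  apply/existsP; apply: contraNT d0; rewrite negb_exists => /forallP h.
  by apply/eqP/rowP => k; rewrite mxE; have := h k; rewrite negbK => /eqP.
rewrite sqrtr_gt0 (bigD1 k) //= ltr_wpDr //.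
  by apply: sumr_ge0 => j _; rewrite sqr_ge0.
rewrite exprn_gt0 // lt_neqAle eq_sym (rnorm_ge0 (d ord0 k)) andbT.
by apply: contra dk => /eqP/(@rnorm0_eq0 R R[i]) ->.
Qed.

Lemma psh_at_const (V : normedModType R[i]) (c : R) (a : V) :
  psh_at (fun=> c) a.
Proof. by apply: psh_at_midpoint_convex => d; exists 1. Qed.

(** On a small circle a contact polynomial puts [f] below a harmonic polynomial whose value at the
    centre is strictly less than [f a], against subharmonicity. *)
Lemma plurisubharmonic_on_psh_at Om f a : open Om ->
  plurisubharmonic_on Om (EFin \o f) -> Om a -> psh_at f a.
Proof.
move=> oOm [_ psh] aOm d al be e rho e0 rho0 bad.
(* The zero direction cannot be normalised; along it [f] is constant. *)
have [d0|d0] := eqVneq d 0.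
  apply: (@psh_at_const E (f a) a d al be e rho) => // w wr.
  by rewrite {1}(_ : a = a + w *: d); [exact: bad|rewrite d0 scaler0 addr0].
set s := euclidean_norm d; have s0 : 0 < s by exact: euclidean_norm_gt0.
pose d1 := (s^-1)%:C *: d.
have d1E : euclidean_norm d1 = 1.
  by rewrite euclidean_norm_real_scale ?invr_ge0 ?ltW // mulVf // gt_eqF.
have [_ sub] := psh a d1 aOm d1E.
have [r1 r10 r1P] := line_near d1 (open_nbhs_nbhs (conj oOm aOm)).
have srho : 0 < rho * s by rewrite mulr_gt0.
set r := Num.min r1 (rho * s) / 2.
have m0 : 0 < Num.min r1 (rho * s) by rewrite lt_min r10.
have r0 : 0 < r by rewrite divr_gt0.
have : r < Num.min r1 (rho * s) by rewrite /r; lra.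
rewrite lt_min => /andP[rr1 rrs].
have disc : [set z | normc (z - 0) <= r] `<=` [set z | Om (a + z *: d1)].
  by move=> z /=; rewrite subr0 => zr; apply: r1P; exact: le_lt_trans rr1.
set k := (s^-1)%:C.
have nk : normc k = s^-1 by rewrite normc_real gtr0_norm // invr_gt0.
(* On the circle the penalty e |w|^2 is constant, so it merges into the constant term and leaves a
   harmonic function. *)
pose c := f a - e * (r / s) ^+ 2.
have bdry z : normc (z - 0) = r ->
    ((f (a + z *: d1))%:E <= (quad c%:C (al * k) (be * k ^+ 2) z)%:E)%E.
  rewrite subr0 => zr; rewrite lee_fin scalerA -/k.
  have nw : normc (z * k) = r / s by rewrite ComplexField.Normc.normcM zr nk.
  have := bad (z * k); rewrite nw ltr_pdivrMr // => /(_ rrs) h.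
  apply: le_trans h _; rewrite le_eqVlt; apply/orP; left; apply/eqP.
  rewrite /quad /c; move: (e * _) (f a) (k) => q fa k'.
  clear; case: al => a1 a2; case: be => b1 b2; case: z => z1 z2.
  case: k' => k1 k2 /=; ring.
have := sub 0 r r0 disc _ (continuous_subspaceT (@quad_continuous _ _ _ _))
  (harmonic_on_quad _ _ _ _) bdry 0.
have n0 : normc (0 : R[i]) = 0 by exact: (@rnorm0 R R[i]).
rewrite subr0 n0 => /(_ r0); rewrite lee_fin scale0r addr0.
rewrite /quad (expr2 0) !mulr0 !addr0 /c /=.
have : 0 < e * (r / s) ^+ 2 by rewrite mulr_gt0 // exprn_gt0 // divr_gt0.
lra.
Qed.

Lemma continuous_usc_on (T : topologicalType) (V : set T) (g : T -> R) :
  (forall x, V x -> {for x, continuous g}) -> usc_on V (EFin \o g).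
Proof.
move=> cg x Vx; split=> [|c]; first exact: ltry.
rewrite lte_fin => gc.
have nb : nbhs (g x) [set s | s < c].
  by apply: open_nbhs_nbhs; split; first exact: open_lt.
have h : \forall y \near x, g y < c := cg x Vx _ nb.
by apply: filterS h => y yc _; rewrite /= lte_fin.
Qed.

(** If [f] exceeded [phi] inside the disc, f - phi + eps |z - b|^2 would have an interior maximum.
    Replacing [phi] there by its second-order expansion gives a contact polynomial. *)
Lemma psh_at_plurisubharmonic_on Om f : open Om ->
  (forall x, Om x -> {for x, continuous f}) ->
  (forall x, Om x -> psh_at f x) -> plurisubharmonic_on Om (EFin \o f).
Proof.
move=> oOm cf pf; split; first exact: continuous_usc_on.
move=> a d aOm _.
have cfl z : Om (a + z *: d) ->
    {for z, continuous (fun z => f (a + z *: d))}.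
  move=> h; apply: (@continuous_comp _ _ _ (fun z => a + z *: d) f).
    exact: line_continuous.
  exact: cf.
split; first exact: (@continuous_usc_on _ _ (fun z => f (a + z *: d))).
move=> b r r0 disc phi cphi hphi bdry z1 z1r.
rewrite lee_fin leNgt; apply/negP => fz1.
pose D := [set z : R[i] | normc (z - b) <= r].
set eta := f (a + z1 *: d) - phi z1.
have eta0 : 0 < eta by rewrite subr_gt0.
have r20 : 0 < r ^+ 2 by rewrite exprn_gt0.
(* On the circle [f - phi] is nonpositive and the quadratic term equals [eta / 2], so the maximum is
   not attained there. *)
set eps := eta / (r ^+ 2 *+ 2).
have eps0 : 0 < eps by rewrite divr_gt0 // mulrn_wgt0.
have epsE : eps * r ^+ 2 = eta / 2 by rewrite /eps; field; rewrite gt_eqF.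
pose g z := f (a + z *: d) - phi z + eps * normc (z - b) ^+ 2.
have z1D : D z1 by apply: ltW.
have c1 : {within D, continuous (fun z => f (a + z *: d))}.
  apply: continuous_in_subspaceT => y /set_mem yD.
  by apply: cfl; exact: disc.
have c2 : {within D, continuous (fun z => eps * normc (z - b) ^+ 2)}.
  apply: continuous_subspaceT.
  suff h (y : R[i]) : eps * normc (z - b) ^+ 2 @[z --> y] -->
    eps * normc (y - b) ^+ 2 by [].
  have FF : Filter (nbhs y) by exact: nbhs_filter.
  apply: cvgMl_tmp; rewrite expr2.
  by apply: cvgM; exact: (@rnormB_continuous R R[i]).
have cg : {within D, continuous g}.
  by move=> z; apply: cvgD; [apply: cvgB; [exact: c1|exact: cphi]|exact: c2].
have cD : compact D by exact: compact_closed_disc.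
have [z0 /set_mem z0D z0max] := compact_EVT_max (ex_intro _ _ z1D) cD cg.
have gz1 : eta <= g z0.
  apply: le_trans (z0max z1 (mem_set z1D)).
  by rewrite /g -/eta lerDl mulr_ge0 ?sqr_ge0 // ltW.
have z0r : normc (z0 - b) < r.
  rewrite lt_neqAle z0D andbT; apply/eqP => z0E.
  have := bdry _ z0E; rewrite lee_fin => h.
  by move: gz1; rewrite /g z0E epsE; lra.
have nz0 : nbhs z0 [set z | normc (z - b) < r].
  exact: (open_nbhs_nbhs (conj (open_rnorm_lt b r) z0r)).
have [al [be]] := harmonic_expansion hphi nz0.
have e2 : 0 < eps / 2 by rewrite divr_gt0.
move=> /(_ _ e2)[rho rho0 exp].
have [rho' rho'0 inD] := (nbhs_rnormP _ _).1 nz0.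
(* The correction of [al] is the cross term of eps |z0 - b + w|^2; half of [eps] absorbs the error
   in expanding [phi]. *)
apply: (pf _ (disc _ z0D) d (al - (eps *+ 2)%:C * (z0 - b)^*) be (eps / 2)
  (Num.min rho rho')) => //; first by rewrite lt_min rho0.
move=> w; rewrite lt_min => /andP[w1 w2].
have wD : D (z0 + w).
  by apply: ltW; apply: inD; rewrite addrAC subrr add0r.
have := z0max _ (mem_set wD); rewrite /g.
have := exp _ w1.
have -> : a + z0 *: d + w *: d = a + (z0 + w) *: d by rewrite scalerDl addrA.
rewrite (addrAC z0 w) (sqr_normcD (z0 - b) w).
have -> : complex.Re ((al - (eps *+ 2)%:C * (z0 - b)^*) * w + be * w ^+ 2) =
  complex.Re (al * w + be * w ^+ 2) - (eps * complex.Re ((z0 - b)^* * w)) *+ 2.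
  move: (z0 - b) => y; clear; case: al => a1 a2; case: be => b1 b2.
  case: w => w1 w2; case: y => y1 y2 /=; ring.
move: (complex.Re _) (complex.Re _) (phi _) (phi _) (f _) (f _).
move: (normc _ ^+ 2) (normc _ ^+ 2) => ? ? ? ? ? ? ? ?; lra.
Qed.

End Equivalence.

(** * Distance to the complement *)

Section BoundaryDistance.
Variables (R : realType) (V : normedModType R[i]).
Implicit Types (x y p : V) (Om W : set V).

(** On C^n this is the sup-norm distance. For [Om = setT] the infimum is over the empty set and
    measures nothing, hence the recurring hypothesis [Om != setT]. *)
Definition bdist Om x : R := inf [set rnorm (x - p) | p in ~` Om].

Lemma bdist_has_lbound Om x : has_lbound [set rnorm (x - p) | p in ~` Om].
Proof. by exists 0 => _ [p _ <-]; exact: rnorm_ge0. Qed.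

Lemma bdist_le Om x p : ~ Om p -> bdist Om x <= rnorm (x - p).
Proof. by move=> Op; apply: ge_inf; [exact: bdist_has_lbound|exists p]. Qed.

Lemma bdist_ge Om x (c : R) : Om != setT ->
  (forall p, ~ Om p -> c <= rnorm (x - p)) -> c <= bdist Om x.
Proof.
move=> /eqP OT h; apply: lb_le_inf; last by move=> _ [p Op <-]; exact: h.
apply/set0P/negP => /eqP E; apply: OT; apply/seteqP; split=> // p _.
apply: contrapT => Op.
have : [set rnorm (x - q) | q in ~` Om] (rnorm (x - p)) by exists p.
by rewrite E.
Qed.

Lemma bdist_lipschitz Om x y : Om != setT ->
  bdist Om x <= rnorm (x - y) + bdist Om y.
Proof.
move=> OT; rewrite -lerBlDl; apply: bdist_ge => // p Op.
rewrite lerBlDl; apply: le_trans (bdist_le _ Op) _; exact: ler_rnormB_add.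
Qed.

Lemma bdist_continuous Om : Om != setT -> continuous (bdist Om).
Proof.
move=> OT x; apply/continuous_rnormP => e e0; exists e => // y yx.
apply: le_lt_trans yx; rewrite ler_norml.
have := bdist_lipschitz x y OT; have := bdist_lipschitz y x OT.
by rewrite (rnormB x) => h1 h2; apply/andP; split; lra.
Qed.

Lemma bdist_ball Om x y : rnorm (y - x) < bdist Om x -> Om y.
Proof.
by rewrite rnormB => h; apply: contrapT => /bdist_le /(lt_le_trans h); rewrite ltxx.
Qed.

Lemma bdist_gt0 Om x : Om != setT -> open Om -> Om x -> 0 < bdist Om x.
Proof.
move=> OT oOm Ox.
have [r r0 rP] := (nbhs_rnormP _ _).1 (open_nbhs_nbhs (conj oOm Ox)).
apply: lt_le_trans r0 _; apply: bdist_ge => // p Op.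
by rewrite leNgt rnormB; apply/negP => /rP.
Qed.

Lemma inv_bdist_continuous Om x : Om != setT -> open Om -> Om x ->
  {for x, continuous (fun y => (bdist Om y)^-1)}.
Proof.
move=> OT oOm Ox; apply: cvgV; first by rewrite gt_eqF // bdist_gt0.
exact: bdist_continuous.
Qed.

End BoundaryDistance.

(** * Truncated reciprocal of a quadratic polynomial *)

Section Reciprocal.
Variable R : realType.
Implicit Types (z w : R[i]).

Lemma Re_le_normc z : complex.Re z <= normc z.
Proof. exact: le_trans (ler_norm _) (ler_Re_normc z). Qed.

(* [1 + g1 w + g2 w^2] is the second order truncation of
   [1 / (1 + (al w + be w^2) / c)]; the cubic error is absorbed by [e |w|^2]. *)
Lemma reciprocal_truncation (al be : R[i]) (c e : R) : 0 < c -> 0 < e ->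
  exists g1 g2 : R[i], exists2 rho : R, 0 < rho &
  forall w, 0 < normc w -> normc w < rho ->
    normc (1 + g1 * w + g2 * w ^+ 2) *
      (c + complex.Re (al * w + be * w ^+ 2) - e * normc w ^+ 2) < c.
Proof.
move=> c0 e0; have cN0 : c%:C != 0 by rewrite eq_complex /= gt_eqF.
set al' := al / c%:C; set be' := be / c%:C.
set g1 := - al'; set g2 := al' ^+ 2 - be'; exists g1, g2.
(* These are the remainder coefficients: g (c + al w + be w^2) = c (1 + w^3 (A + B w)). *)
set A := al' * g2 - al' * be'; set B := be' * g2.
pose G := normc g1 + normc g2; pose H := normc A + normc B.
have G0 : 0 <= G by rewrite addr_ge0 //; [exact: (rnorm_ge0 g1)|exact: (rnorm_ge0 g2)].
have H0 : 0 <= H by rewrite addr_ge0 //; [exact: (rnorm_ge0 A)|exact: (rnorm_ge0 B)].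
have cH0 : 0 <= c * H by rewrite mulr_ge0 // ltW.
(* In turn: higher powers of |w| are dominated by lower ones; |g| stays at least 1/2, so the penalty
   keeps half its size; the cubic error falls below that half. *)
exists (Num.min 1 (Num.min (2 * (G + 1))^-1 (e / (2 * (c * H + 1))))).
  by rewrite !lt_min ltr01 invr_gt0 divr_gt0 ?mulr_gt0 // ltr_wpDl.
move=> w w0; rewrite !lt_min => /and3P[w1 w2 w3].
have nM (x y : R[i]) : normc (x * y) = normc x * normc y.
  exact: ComplexField.Normc.normcM.
have n1 : normc (1 : R[i]) = 1 by exact: ComplexField.Normc.normc1.
have nD (x y : R[i]) : normc (x + y) <= normc x + normc y := ler_rnormD x y.
have nX2 : normc (w ^+ 2) = normc w ^+ 2 by rewrite !expr2 nM.
have nX3 : normc (w ^+ 3) = normc w ^+ 3 by rewrite exprS nM nX2 -exprS.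
move: w0 w1 w2 w3 nX2 nX3.
move xE : (normc w) => x w0 w1 w2 w3 nX2 nX3.
have x2 : x ^+ 2 <= x by rewrite expr2 ler_piMl // ltW.
have x20 : 0 < x ^+ 2 by rewrite exprn_gt0.
set g := 1 + g1 * w + g2 * w ^+ 2.
have w2' : x * (2 * (G + 1)) < 1 by rewrite -ltr_pdivlMr ?div1r // mulr_gt0 // ltr_wpDl.
have w3' : x * (2 * (c * H + 1)) < e by rewrite -ltr_pdivlMr // mulr_gt0 // ltr_wpDl.
have glow : 1 / 2 <= normc g.
  have h : 1 <= normc g + (normc g1 * x + normc g2 * x ^+ 2).
    rewrite -n1 (_ : 1 = g + (- (g1 * w) + - (g2 * w ^+ 2))); last first.
      by rewrite /g; ring.
    apply: le_trans (nD _ _) _; rewrite lerD2l; apply: le_trans (nD _ _) _.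
    have nN (y : R[i]) : normc (- y) = normc y := rnormN y.
    by rewrite (nN (g1 * w)) (nN (g2 * w ^+ 2)) (nM g1) (nM g2) nX2 xE.
  have h2 : normc g2 * x ^+ 2 <= normc g2 * x.
    by rewrite ler_wpM2l //; exact: (rnorm_ge0 g2).
  move: h h2 w2'; rewrite /G.
  move: (normc g) (normc g1) (normc g2) => ? ? ? ? ? ?; lra.
have prod : g * (c%:C + al * w + be * w ^+ 2) = c%:C * (1 + w ^+ 3 * (A + B * w)).
  have -> : al = c%:C * al' by rewrite mulrC divfK.
  have -> : be = c%:C * be' by rewrite mulrC divfK.
  rewrite /g /A /B /g1 /g2; ring.
have nprod : normc g * normc (c%:C + al * w + be * w ^+ 2) <=
    c + c * H * (x * x ^+ 2).
  rewrite -nM prod nM normc_real gtr0_norm //.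
  have -> : c + c * H * (x * x ^+ 2) = c * (1 + H * (x * x ^+ 2)) by ring.
  rewrite ler_pM2l //.
  have h1 := nD 1 (w ^+ 3 * (A + B * w)); rewrite n1 (nM (w ^+ 3)) nX3 in h1.
  have h2 : normc (A + B * w) <= H.
    have h3 := nD A (B * w); rewrite (nM B) xE in h3.
    have h4 : normc B * x <= normc B 
      by apply: ler_piMr; [exact: (rnorm_ge0 B)|exact: ltW].
    by rewrite /H; lra.
  apply: le_trans h1 _; rewrite lerD2l mulrC -exprS ler_wpM2r // ltW //.
  by rewrite exprn_gt0.
have Rele : c + complex.Re (al * w + be * w ^+ 2) <=
    normc (c%:C + al * w + be * w ^+ 2).
  apply: le_trans (Re_le_normc _); rewrite le_eqVlt; apply/orP; left; apply/eqP.
  by rewrite -addrA; case: (_ + be * _) => ? ? /=.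
have g0 : 0 <= normc g by exact: (rnorm_ge0 g).
have s1 : normc g * (c + complex.Re (al * w + be * w ^+ 2)) <=
    c + c * H * (x * x ^+ 2).
  by apply: le_trans nprod; rewrite ler_wpM2l.
have s2 : 1 / 2 * (e * x ^+ 2) <= normc g * (e * x ^+ 2).
  by rewrite ler_wpM2r // mulr_ge0 // ltW.
have s3 : x * (2 * (c * H + 1)) * x ^+ 2 < e * x ^+ 2 by rewrite ltr_pM2r.
have s4 : 0 < x * x ^+ 2 by rewrite mulr_gt0.
rewrite mulrBr; lra.
Qed.

End Reciprocal.

(** * The continuity principle for the distance *)

Section ContinuityPrinciple.
Variables (R : realType) (n : nat).
Notation E := 'rV[R[i]]_n.
Implicit Types (f : E -> R) (a d : E) (Om : set E) (z w : R[i]).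

(** Only the points of the complement no farther than a fixed [p0] compete, and they form a compact
    set. *)
Lemma bdist_attained Om a : Om != setT -> open Om ->
  exists2 p, ~ Om p & rnorm (a - p) = bdist Om a.
Proof.
move=> OT oOm.
have [p0 Op0] : exists p, ~ Om p.
  apply: contrapT => /forallNP h; move/eqP: OT; apply.
  by apply/seteqP; split=> // p _; exact: contrapT (h p).
pose B := ~` Om `&` [set p | rnorm (p - a) <= rnorm (p0 - a)].
have cB : compact B.
  apply: (@rV_bounded_closed_compact _ _ _ (rnorm (p0 - a) + rnorm a)).
    move=> p [_ /= pa]; rewrite -(subrK a p).
    by apply: le_trans (ler_rnormD _ _) _; rewrite lerD2r.
  by apply: closedI; [exact: open_closedC|exact: closed_rnorm_le].
have Bp0 : B p0 by split => //=.
have cr : {within B, continuous (fun p : E => rnorm (p - a))}.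
  by apply: continuous_subspaceT; exact: rnormB_continuous.
have [p /set_mem[Op pa] pmin] := compact_EVT_min (ex_intro _ _ Bp0) cB cr.
exists p => //; apply/eqP; rewrite eq_le bdist_le // andbT.
apply: bdist_ge => // q Oq; rewrite (rnormB a p) (rnormB a q).
have [h|/ltW h] := leP (rnorm (q - a)) (rnorm (p0 - a)).
  by apply: pmin; apply/mem_set; split.
exact: le_trans pa h.
Qed.

(* If [1 / bdist] were touched from above at [a], the quadratic discs below would
   stay in [Om] for [|t| < 1], with boundaries in a fixed compact subset of [Om],
   while their centres tend to a boundary point as [t] tends to 1. *)
Theorem psh_at_inv_bdist Om f a : open Om -> Om != setT ->
  (forall x, Om x -> {for x, continuous f}) ->
  (forall x, Om x -> psh_at f x) -> exhaustion_on Om f ->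
  Om a -> psh_at (fun x => (bdist Om x)^-1) a.
Proof.
move=> oOm OT cf pf ex aOm d al be e rho e0 rho0 bad.
have del0 : 0 < bdist Om a by exact: bdist_gt0.
set c := (bdist Om a)^-1; have c0 : 0 < c by rewrite invr_gt0.
have [p Op pE] := bdist_attained a OT oOm.
pose u := p - a; have uE : rnorm u = c^-1 by rewrite /u rnormB pE invrK.
have [g1 [g2 [r1 r10 trunc]]] := reciprocal_truncation al be c0 e0.
have [r2 r20 inOm] := line_near d (open_nbhs_nbhs (conj oOm aOm)).
have [r [r0 rrho rr1 rr2]] : exists r : R, [/\ 0 < r, r < rho, r < r1 & r < r2].
  pose m := Num.min (Num.min rho r1) r2.
  have m0 : 0 < m by rewrite !lt_min rho0 r10.
  exists (m / 2); have : m / 2 < m by lra.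
  by rewrite !lt_min divr_gt0 // => /andP[/andP[]].
pose g w := 1 + g1 * w + g2 * w ^+ 2.
(* The contact bound on 1 / bdist and the truncated reciprocal combine: the vector [g w *: u], of
   length |g w| / c, is shorter than the distance from [a + w *: d] to the complement. *)
have gd w : 0 < normc w -> normc w <= r ->
    normc (g w) * c^-1 < bdist Om (a + w *: d).
  move=> w0 wr; have wOm : Om (a + w *: d).
    by apply: inOm; exact: le_lt_trans rr2.
  have b0 : 0 < bdist Om (a + w *: d) by exact: bdist_gt0.
  have wrho : normc w < rho by exact: le_lt_trans rrho.
  have wr1 : normc w < r1 by exact: le_lt_trans rr1.
  have h1 := bad w wrho; have h2 := trunc w w0 wr1.
  rewrite ltr_pdivrMr // -ltr_pdivrMl // mulrC.
  by apply: le_lt_trans h2; rewrite ler_wpM2l //; exact: (rnorm_ge0 (g w)).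
(* This is [a + w *: d + (t * g w) *: u] grouped by powers of w: for fixed t, a quadratic disc
   centred at [a + t *: u]. *)
pose D (q : R[i] * R[i]) : E :=
  (a + q.1 *: u) + q.2 *: (d + (q.1 * g1) *: u) + q.2 ^+ 2 *: ((q.1 * g2) *: u).
have DE t w : D (t, w) = (a + w *: d) + (t * g w) *: u.
  have -> : t * g w = t + w * (t * g1) + w ^+ 2 * (t * g2) by rewrite /g; ring.
  rewrite /D [_.1]/= [_.2]/= (scalerDl u (t + _)) (scalerDl u t) -!scalerA.
  rewrite (scalerDr w d); move: (t *: u) (w *: d)  => X W.
  move: (w *: (t *: _)) (w *: (w *: _)) => Y Z.
  by rewrite (addrACA a) -(addrA (a + W)).
have DOm t w : normc t <= 1 -> normc w <= r -> (normc t < 1 \/ 0 < normc w) ->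
    Om (D (t, w)).
  move=> t1 wr h; rewrite DE; apply: (@bdist_ball _ _ _ (a + w *: d)).
  rewrite addrAC subrr add0r rnormZ uE ComplexField.Normc.normcM.
  have [w0|w0] := ltP 0 (normc w).
    have tg : normc t * normc (g w) <= normc (g w).
      by apply: ler_piMl => //; exact: (rnorm_ge0 (g w)).
    by apply: le_lt_trans (gd w w0 wr); rewrite ler_wpM2r // invr_ge0 ltW.
  have t1' : normc t < 1 by case: h => //; rewrite ltNge w0.
  have nw0 : normc w = 0.
    by apply/eqP; rewrite eq_le w0; exact: (rnorm_ge0 w).
  have -> : w = 0 by exact: (@rnorm0_eq0 R R[i] w nw0).
  have -> : g 0 = 1 by rewrite /g; ring.
  rewrite scale0r addr0 ComplexField.Normc.normc1 mulr1 /c invrK.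
  by rewrite gtr_pMl.
have cD : continuous D.
  suff h (q : R[i] * R[i]) : D y @[y --> q] --> D q by [].
  have FF : Filter (nbhs q) by exact: nbhs_filter.
  have c1 : (fun y : R[i] * R[i] => y.1) y @[y --> q] --> q.1 by exact: cvg_fst.
  have c2 : (fun y : R[i] * R[i] => y.2) y @[y --> q] --> q.2 by exact: cvg_snd.
  have k1 (k : R[i]) :
      (fun y : R[i] * R[i] => y.1 * k) y @[y --> q] --> q.1 * k.
    by apply: (cvg_complexM c1); exact: cvg_cst.
  have c22 : (fun y : R[i] * R[i] => y.2 * y.2) y @[y --> q] --> q.2 * q.2.
    exact: (cvg_complexM c2 c2).
  apply: cvgD; first apply: cvgD; first apply: cvgD.
  - exact: cvg_cst.
  - exact: (cvg_complexZ c1).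
  - apply: (cvg_complex_scale c2).
    by apply: cvgD; [exact: cvg_cst|exact: (cvg_complexZ (k1 g1))].
  - by apply: (cvg_complex_scale c22); exact: (cvg_complexZ (k1 g2)).
have n0 : normc (0 : R[i]) = 0 by exact: (@rnorm0 R R[i]).
(* [S] is the circle |w| = r. Off w = 0 even |t| = 1 stays in [Om], so all disc boundaries lie in
   the compact image of [T]. *)
pose S := [set w : R[i] | normc (w - 0) <= r] `&` [set w | r <= rnorm w].
have SE w : S w -> normc w = r.
  by move=> [/=]; rewrite subr0 => h1 h2; apply/eqP; rewrite eq_le h1.
have cS : compact S.
  apply: (@subclosed_compact _ _ [set w : R[i] | normc (w - 0) <= r]).
  - apply: closedI; first exact: closed_rnorm_le.
    apply: (@preimage_closed _ _ (@rnorm R R[i]) [set t | r <= t]).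
      by move=> ? _; exact: rnorm_continuous.
    exact: closed_ge.
  - exact: compact_closed_disc.
  - by move=> ? [].
pose T := [set t : R[i] | normc (t - 0) <= 1] `*` S.
have cT : compact T by apply: compact_setX => //; exact: compact_closed_disc.
have T0 : T (0, r%:C).
  split; first by rewrite /mkset subr0 n0.
  by split; rewrite /mkset ?subr0 ?rnormcE normc_real gtr0_norm.
have cfD : {within T, continuous (f \o D)}.
  apply: continuous_in_subspaceT => -[t w] /set_mem[/= t1 /SE wS].
  apply: continuous_comp; first exact: cD.
  apply: cf; rewrite subr0 in t1; apply: DOm => //; first by rewrite wS.
  by right; rewrite wS.
have [q _ qmax] := compact_EVT_max (ex_intro _ _ T0) cT cfD.
set M := (f \o D) q in qmax.
have fM t : normc t < 1 -> f (a + t *: u) <= M.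
  move=> t1; apply: (@psh_disc_max R E f Om (a + t *: u) (d + (t * g1) *: u)
    ((t * g2) *: u) r M oOm cf pf r0) => z zr.
    have h : Om (D (t, z)) by apply: DOm; [exact: ltW|exact: zr|left].
    exact: h.
  have h : T (t, z).
    split; first by rewrite /mkset subr0 ltW.
    by split; rewrite /mkset ?subr0 ?rnormcE zr.
  exact: (qmax (t, z) (mem_set h)).
(* The points [a + t *: u] tend to [p] as t increases to 1, so the closed sublevel set would contain
   [p], which is outside [Om]. *)
have clK : closed (Om `&` [set x | f x <= M]).
  by apply: compact_closed; [exact: norm_hausdorff|exact: ex].
apply: Op; suff /clK[] : closure (Om `&` [set x | f x <= M]) p by [].
move=> B pB; have [eta eta0 etaB] := line_near u pB.
have [h [h0 h1 heta]] : exists h : R, [/\ 0 < h, h < 1 & h < eta].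
  have m0 : 0 < Num.min 1 eta by rewrite lt_min ltr01.
  exists (Num.min 1 eta / 2); have : Num.min 1 eta / 2 < Num.min 1 eta by lra.
  by rewrite lt_min divr_gt0 // => /andP[].
have pt : p + (- h%:C) *: u = a + (1 - h)%:C *: u.
  by rewrite rmorphB rmorph1 scalerBl scale1r scaleNr /u addrA subrKC.
have t1 : normc (1 - h)%:C < 1 by rewrite normc_real gtr0_norm; lra.
exists (p + (- h%:C) *: u); split; last first.
  apply: etaB; have nN (y : R[i]) : normc (- y) = normc y := rnormN y.
  by rewrite nN normc_real gtr0_norm.
rewrite pt; split; last exact: fM.
have := DOm (1 - h)%:C 0 (ltW t1); rewrite DE scale0r addr0 n0.
have -> : g 0 = 1 by rewrite /g; ring.
by rewrite mulr1; apply; [exact: ltW|left].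
Qed.

End ContinuityPrinciple.

(** * Components of open sets and their exhaustions *)

Section Components.
Variables (R : realType) (V : normedModType R[i]).
Implicit Types (a x y : V) (A : set V).

Lemma connected_rnorm_lt x (r : R) : connected [set y | rnorm (y - x) < r].
Proof.
have [r0|r0] := leP r 0.
  rewrite (_ : mkset _ = set0); first exact: connected0.
  apply/seteqP; split => // y /= yr.
  by have := rnorm_ge0 (y - x); rewrite leNgt (lt_le_trans yr r0).
pose seg y : set V := (fun t : R => x + t%:C *: (y - x)) @` `[0, 1]%classic.
rewrite (_ : mkset _ = \bigcup_(y in [set y | rnorm (y - x) < r]) seg y).
  apply: bigcup_connected.
    exists x => y _; exists 0; first by rewrite /= in_itv /= lexx ler01.
    by rewrite scale0r addr0.
  move=> y _; apply: connected_continuous_connected.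
    exact: segment_connected.
  apply: continuous_subspaceT => t.
  apply: (@continuous_comp _ _ _ (real_complex R) (fun z => x + z *: (y - x))).
    apply/cvgrPdist_lt => e e0.
    have eE : e = (complex.Re e)%:C by rewrite RRe_real // gtr0_real.
    near=> s; rewrite -rmorphB rnormE eE ltcR rnormcE normc_real.
    by near: s; apply: (@nbhsx_ballx R R^o t); rewrite -ltcR -eE.
  exact: line_continuous.
apply/seteqP; split=> [y yr|z [y /= yr] [t /=]].
  exists y => //; exists 1; first by rewrite /= in_itv /= lexx ler01.
  by rewrite scale1r subrKC.
rewrite in_itv /= => /andP[t0 t1] <-.
rewrite addrAC subrr add0r rnormZ normc_real ger0_norm //.
by apply: le_lt_trans yr; rewrite ler_piMl // rnorm_ge0.
Unshelve. all: by end_near. Qed.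

Lemma rnorm_lt_sub_component A x y (r : R) :
  connected_component A x y -> 0 < r ->
  (forall z, rnorm (z - y) < r -> A z) ->
  forall z, rnorm (z - y) < r -> connected_component A x z.
Proof.
move=> Axy r0 rA z zr; apply: connected_component_trans Axy _.
apply: (@connected_component_max _ _ [set z | rnorm (z - y) < r]) => //.
  by rewrite /= subrr rnorm0.
exact: connected_rnorm_lt.
Qed.

Lemma component_open A x : open A -> open (connected_component A x).
Proof.
move=> oA; rewrite openE => y Axy.
have Ay := connected_component_sub Axy.
have [r r0 rA] := (nbhs_rnormP _ _).1 (open_nbhs_nbhs (conj oA Ay)).
apply/nbhs_rnormP; exists r => //.
exact: rnorm_lt_sub_component Axy r0 rA.
Qed.

(** The component of [y] is a neighbourhood of [y], so it meets that of [x] and the two coincide. *)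
Lemma component_relatively_closed A x y : open A -> A y ->
  closure (connected_component A x) y -> connected_component A x y.
Proof.
move=> oA Ay cly.
have oy := component_open y oA.
have yy : connected_component A y y by exact: connected_component_refl.
have [z [Axz Ayz]] := cly _ (open_nbhs_nbhs (conj oy yy)).
exact: connected_component_trans Axz (connected_component_sym Ayz).
Qed.

Lemma closed_compact_sublevel (A : set V) (f : V -> R) :
  exhaustion_on A f -> forall r, closed (A `&` [set x | f x <= r]).
Proof. by move=> ex r; apply: compact_closed; [exact: norm_hausdorff|exact: ex]. Qed.

(** Relative closedness makes each sublevel set in the component a closed subset of the compact one
    in [A]. *)
Lemma exhaustion_on_component A x (f : V -> R) : open A ->
  exhaustion_on A f -> exhaustion_on (connected_component A x) f.
Proof.
move=> oA ex r; apply: (@subclosed_compact _ _ (A `&` [set x | f x <= r])).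
- move=> y cly; have [Ay fy] : (A `&` [set x | f x <= r]) y.
    apply: closed_compact_sublevel => //.
    by apply: closureS cly => z [/connected_component_sub ? ?].
  split => //; apply: component_relatively_closed => //.
  by apply: closureS cly => z [].
- exact: ex.
- by move=> z [/connected_component_sub].
Qed.

End Components.

(** * Pseudoconvexity and its local form *)

Section Pseudoconvexity.
Variables (R : realType) (n : nat).
Notation E := 'rV[R[i]]_n.
Implicit Types (f : E -> R) (a c x y : E) (U W : set E).

Lemma pseudoconvexP U : pseudoconvex U <-> domain U /\
  exists f, [/\ forall x, U x -> {for x, continuous f},
    forall x, U x -> psh_at f x & exhaustion_on U f].
Proof.
split=> -[dU [f [h1 h2 h3]]]; split => //; exists f; split => //.
- move: h1; rewrite continuous_open_subspace; last by case: dU.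
  by move=> h1 x Ux; apply: h1; exact/mem_set.
- by move=> x; apply: plurisubharmonic_on_psh_at => //; case: dU.
- by apply: continuous_in_subspaceT => x /set_mem; exact: h1.
- by apply: psh_at_plurisubharmonic_on => //; case: dU.
Qed.

Lemma inv_gap_le (s r t : R) : s < r -> 0 < t ->
  ((r - s)^-1 <= t) = (s <= r - t^-1).
Proof.
move=> sr t0; have sr0 : 0 < r - s by rewrite subr_gt0.
by rewrite -[leRHS]invrK lef_pV2 ?posrE ?invr_gt0 // lerBrDl lerBrDl addrC.
Qed.

(** It blows up on approach to the sphere from inside; on the sphere the inverse of 0 is 0 by
    convention, so only values in the open ball are meaningful. *)
Definition ball_barrier c (r : R) x : R := (r - rnorm (x - c))^-1.

Lemma ball_barrier_continuous c (r : R) x : rnorm (x - c) < r ->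
  {for x, continuous (ball_barrier c r)}.
Proof.
move=> xr; have h : 0 < r - rnorm (x - c) by rewrite subr_gt0.
have FF : Filter (nbhs x) by exact: nbhs_filter.
suff : (r - rnorm (y - c))^-1 @[y --> x] --> (r - rnorm (x - c))^-1 by [].
apply: cvgV; first by rewrite gt_eqF.
by apply: cvgB; [exact: cvg_cst|exact: rnormB_continuous].
Qed.

Lemma max_continuous_at (f g : E -> R) x :
  {for x, continuous f} -> {for x, continuous g} ->
  {for x, continuous (fun y => Num.max (f y) (g y))}.
Proof. by move=> cf cg; exact: (@continuous_max _ _ f g x cf cg). Qed.

Lemma open_truncation U c (r : R) : open U ->
  open (U `&` [set x | rnorm (x - c) < r]).
Proof. by move=> oU; apply: openI => //; exact: open_rnorm_lt. Qed.

(** Closed sublevel sets of [f] suffice: a bound [s > 0] on the barrier confines points to a smaller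
    closed ball. For [s <= 0] the sublevel set is empty, the barrier being positive. *)
Lemma truncation_exhaustion U f c (r : R) :
  (forall s, closed (U `&` [set x | f x <= s])) ->
  exhaustion_on (U `&` [set x | rnorm (x - c) < r])
    (fun x => Num.max (f x) (ball_barrier c r x)).
Proof.
move=> cl s; have [s0|s0] := leP s 0.
  rewrite [X in compact X](_ : _ = set0); first exact: compact0.
  apply/seteqP; split => // x [[_ /= xr]]; rewrite /= ge_max => /andP[_].
  by rewrite leNgt (le_lt_trans s0) // invr_gt0 subr_gt0.
rewrite [X in compact X](_ : _ = (U `&` [set x | f x <= s]) `&`
    [set x | rnorm (x - c) <= r - s^-1]).
  apply: (@rV_bounded_closed_compact _ _ _ (r - s^-1 + rnorm c)).
    move=> x [_ /= xr]; rewrite -(subrK c x).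
    by apply: le_trans (ler_rnormD _ _) _; rewrite lerD2r.
  by apply: closedI => //; exact: closed_rnorm_le.
apply/seteqP; split=> x [].
  move=> [Ux /= xr]; rewrite /= ge_max /ball_barrier inv_gap_le //.
  by move=> /andP[? ?]; split.
move=> [Ux /= fx] /= xr.
have xr' : rnorm (x - c) < r by apply: le_lt_trans xr _; rewrite ltrBlDr ltrDl invr_gt0.
by split => //=; rewrite ge_max fx /ball_barrier inv_gap_le.
Qed.

Lemma pseudoconvex_locally U : pseudoconvex U -> locally_pseudoconvex U.
Proof.
move=> /pseudoconvexP[[oU _] [f [cf pf ex]]] a _.
exists [set x | rnorm (x - a) < 1]; split.
  by split; [exact: open_rnorm_lt|rewrite /= subrr rnorm0].
move=> x Ux; have oA := @open_truncation U a 1 oU; apply/pseudoconvexP; split.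
  by split; [exact: component_open|exact: component_connected].
exists (fun y => Num.max (f y) (ball_barrier a 1 y)); split.
- move=> y /connected_component_sub[Uy ya].
  by apply: max_continuous_at; [exact: cf|exact: ball_barrier_continuous].
- move=> y /connected_component_sub[Uy ya].
  by apply: psh_at_max; [exact: pf|exact: psh_at_inv_rnorm].
- apply: exhaustion_on_component => //; apply: truncation_exhaustion.
  exact: closed_compact_sublevel.
Qed.

(** For [s > 0] the set is that of [bdist U x >= s^-1], since a positive distance already forces [x]
    into [U]. *)
Lemma closed_inv_bdist_sublevel U (s : R) : open U -> U != setT ->
  closed (U `&` [set x | (bdist U x)^-1 <= s]).
Proof.
move=> oU UT; have [s0|s0] := leP s 0.
  rewrite (_ : _ `&` _ = set0); first exact: closed0.
  apply/seteqP; split => // x [Ux /=].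
  by rewrite leNgt (le_lt_trans s0) // invr_gt0 bdist_gt0.
rewrite (_ : _ `&` _ = bdist U @^-1` [set t | s^-1 <= t]).
  by apply: preimage_closed; [move=> ? _; exact: bdist_continuous|exact: closed_ge].
apply/seteqP; split=> x /=.
  by move=> [Ux]; rewrite -[leRHS]invrK lef_pV2 ?posrE ?invr_gt0 // bdist_gt0.
move=> xs; have x0 : 0 < bdist U x by apply: lt_le_trans xs; rewrite invr_gt0.
split; first by apply: (@bdist_ball _ _ _ x); rewrite subrr rnorm0.
by rewrite -[leRHS]invrK lef_pV2 ?posrE ?invr_gt0.
Qed.

(** Near [a] the distance to the complement of [U] agrees with that of the component through [z], to
    which [psh_at_inv_bdist] applies. *)
Lemma psh_at_inv_bdist_near_boundary U a : open U -> ~ U a ->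
  locally_pseudoconvex_at U a ->
  exists2 r : R, 0 < r & forall z, U z -> rnorm (z - a) < r ->
    psh_at (fun x => (bdist U x)^-1) z.
Proof.
move=> oU Ua [V [[oV Va] pcV]].
have [s s0 sV] := (nbhs_rnormP _ _).1 (open_nbhs_nbhs (conj oV Va)).
exists (s / 3); first by rewrite divr_gt0.
move=> z Uz za; have Vz : V z by apply: sV; apply: lt_trans za _; lra.
have /pseudoconvexP[[oW _] [f [cf pf ex]]] := pcV z (conj Uz Vz).
set W := connected_component (U `&` V) z in oW cf pf ex.
have WU x : W x -> U x by move=> /connected_component_sub[].
have UT : U != setT by apply/eqP => h; apply: Ua; rewrite h.
have WT : W != setT by apply/eqP => h; apply: Ua; apply: WU; rewrite h.
have Wz : W z by exact: connected_component_refl.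
have eqd y : W y -> rnorm (y - a) < s / 3 -> bdist W y = bdist U y.
  move=> Wy ya; apply/eqP; rewrite eq_le; apply/andP; split.
    by apply: bdist_ge => // p Up; apply: bdist_le => /WU.
  apply: bdist_ge => // p Wp; rewrite leNgt; apply/negP => yp; apply: Wp.
  have d0 : 0 < bdist U y by apply: bdist_gt0 => //; exact: WU.
  (* The ball of radius [bdist U y] about [y] lies in [U]; as [bdist U y <= rnorm (y - a) < s / 3],
     it stays within 2s/3 of [a], hence in [V]. *)
  apply: (rnorm_lt_sub_component Wy d0); last by rewrite rnormB.
  move=> q qy; split; first exact: bdist_ball qy.
  apply: sV; apply: le_lt_trans (ler_rnormB_add _ y _) _.
  by have := bdist_le y Ua; lra.
have nz : \forall y \near z, W y /\ rnorm (y - a) < s / 3.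
  have h := @open_truncation W a (s / 3) oW.
  exact: (open_nbhs_nbhs (conj h (conj Wz za))).
apply: (@psh_at_le _ _ (fun x => (bdist W x)^-1)).
- by near=> y; rewrite eqd //; by have [] : W y /\ rnorm (y - a) < s / 3 by near: y.
- by rewrite eqd.
- exact: psh_at_inv_bdist ex Wz.
Unshelve. all: by end_near. Qed.

(** Bad points in the ball cannot accumulate at the boundary of [U], so their closure is a compact
    subset of [U], on which 1 / bdist is bounded. *)
Lemma psh_at_inv_bdist_or_bounded U (r : R) : open U -> U != setT ->
  locally_pseudoconvex U ->
  exists C : R, forall z, U z -> rnorm (z - 0) < r ->
    psh_at (fun x => (bdist U x)^-1) z \/ (bdist U z)^-1 <= C.
Proof.
move=> oU UT lp; set h := fun x => (bdist U x)^-1.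
pose S := [set z | [/\ U z, rnorm (z - 0) <= r & ~ psh_at h z]].
have cS : compact (closure S).
  apply: (@rV_bounded_closed_compact _ _ _ r); last exact: closed_closure.
  move=> v clv; rewrite -(subr0 v); apply: (@closed_rnorm_le _ _ 0 r v).
  by apply: closureS clv => z [].
have SU y : closure S y -> U y.
  move=> cly; apply: contrapT => Uy.
  have bU : boundary U y.
    split; first by apply: closureS cly => z [].
    by move=> /interior_subset.
  have [s s0 sP] := psh_at_inv_bdist_near_boundary oU Uy (lp _ bU).
  have [z [[Uz _ nz] zy]] := cly _ (near_rnorm y s0).
  by apply: nz; exact: sP.
have [S0|S0] := pselect (closure S !=set0); last first.
  exists 0 => z Uz zr; left; apply: contrapT => nz; apply: S0; exists z.
  by apply: subset_closure; split => //; exact: ltW.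
have ch : {within closure S, continuous h}.
  apply: continuous_in_subspaceT => x /set_mem/SU.
  exact: inv_bdist_continuous.
have [p _ pmax] := compact_EVT_max S0 cS ch.
exists (h p) => z Uz zr; have [|nz] := pselect (psh_at h z); first by left.
right; apply: pmax; apply/mem_set; apply: subset_closure; split => //.
exact: ltW.
Qed.

Lemma locally_pseudoconvex_psh_at_inv_bdist U z : open U -> U != setT ->
  locally_pseudoconvex U -> U z -> psh_at (fun x => (bdist U x)^-1) z.
Proof.
move=> oU UT lp Uz.
(* For |y - z| < 1 the points beyond radius [r] are at least [bdist U z + 2] away from [y], while
   [bdist U y] is below [bdist U z + 1]: the truncation leaves the distance unchanged near [z]. *)
pose r := rnorm z + bdist U z + 3; pose W := U `&` [set x | rnorm (x - 0) < r].
have oW : open W by exact: open_truncation.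
have WT : W != setT.
  apply: contra UT => /eqP WT; apply/eqP/seteqP; split => // x _.
  by have [] : W x by rewrite WT.
have b0 : 0 < bdist U z by exact: bdist_gt0.
have Wz : W z by split => //=; rewrite subr0 /r; lra.
have [C hC] := psh_at_inv_bdist_or_bounded r oU UT lp.
pose g x := Num.max (Num.max (bdist U x)^-1 C) (ball_barrier 0 r x).
have pW : psh_at (fun x => (bdist W x)^-1) z.
  apply: (@psh_at_inv_bdist _ _ W g) => //.
  - move=> x [Ux xr]; apply: max_continuous_at.
      by apply: max_continuous_at; [exact: inv_bdist_continuous|exact: cst_continuous].
    exact: ball_barrier_continuous.
  - move=> x [Ux xr]; apply: psh_at_max; last exact: psh_at_inv_rnorm.
    (* Where 1 / bdist may fail, it is at most [C], and the constant alone gives the property of the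
       maximum. *)
    have [p|le] := hC x Ux xr.
      by apply: psh_at_max => //; exact: psh_at_const.
    by apply: psh_at_maxr => //; exact: psh_at_const.
  - apply: truncation_exhaustion => s.
    have [Cs|Cs] := leP C s; last first.
      rewrite (_ : _ `&` _ = set0); first exact: closed0.
      by apply/seteqP; split => // x [_ /=]; rewrite ge_max (leNgt C) Cs andbF.
    rewrite (_ : _ `&` _ = U `&` [set x | (bdist U x)^-1 <= s]).
      exact: closed_inv_bdist_sublevel.
    by apply/seteqP; split => x [Ux /=]; rewrite ge_max Cs andbT.
have eqd y : rnorm (y - z) < 1 -> bdist W y = bdist U y.
  move=> yz; apply/eqP; rewrite eq_le; apply/andP; split.
    by apply: bdist_ge => // p Up; apply: bdist_le => -[].
  apply: bdist_ge => // p Wp; have [Up|Up] := pselect (U p); last exact: bdist_le.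
  have pr : r <= rnorm p.
    by rewrite leNgt; apply/negP => h; apply: Wp; split; rewrite /= ?subr0.
  have h1 := bdist_lipschitz y z UT; have h2 := ler_rnormD (p - y) y.
  have h3 := ler_rnormD (y - z) z; move: h2 h3; rewrite !subrK (rnormB p) /r in pr *.
  lra.
apply: (psh_at_le _ _ pW); last by rewrite eqd // subrr rnorm0.
apply/nbhs_rnormP; exists 1 => // y yz.
by rewrite eqd.
Qed.

Lemma locally_pseudoconvex_pseudoconvex U : domain U ->
  locally_pseudoconvex U -> pseudoconvex U.
Proof.
move=> dU lp; have [oU _] := dU; apply/pseudoconvexP; split => //.
have cptB (A : set E) (r : R) : closed A ->
    compact (A `&` [set x | rnorm (x - 0) <= r]).
  move=> cA; apply: (@rV_bounded_closed_compact _ _ _ r).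
    by move=> v [_ /=]; rewrite subr0.
  by apply: closedI => //; exact: closed_rnorm_le.
(* The whole space has no complement to measure from; there the norm itself is the exhaustion. *)
have [->|UT] := eqVneq U setT.
  exists (fun x => rnorm (x - 0)); split.
  - by move=> x _; exact: rnormB_continuous.
  - by move=> x _; exact: psh_at_rnorm.
  - by move=> r; exact: cptB closedT.
exists (fun x => Num.max (bdist U x)^-1 (rnorm (x - 0))); split.
- move=> x Ux; apply: max_continuous_at; first exact: inv_bdist_continuous.
  exact: rnormB_continuous.
- move=> x Ux; apply: psh_at_max; last exact: psh_at_rnorm.
  exact: locally_pseudoconvex_psh_at_inv_bdist.
- move=> r; rewrite [X in compact X](_ : _ =
      (U `&` [set x | (bdist U x)^-1 <= r]) `&` [set x | rnorm (x - 0) <= r]).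
    by apply: cptB; exact: closed_inv_bdist_sublevel.
  apply/seteqP; split => x [].
    by move=> Ux; rewrite /= ge_max => /andP[].
  by move=> [Ux /= h1] /= h2; split => //=; rewrite ge_max h1.
Qed.

End Pseudoconvexity.

Theorem theorem4p20 (R : realType) (n : nat) (U : set 'rV[R[i]]_n)
    (hU : domain U) :
  pseudoconvex U <-> locally_pseudoconvex U.
Proof.
split; first exact: pseudoconvex_locally.
exact: locally_pseudoconvex_pseudoconvex.
Qed.
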